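(* Suppose each $f_i$ is convex and differentiable with $(1/\gamma_i)$-Lipschitz continuous gradient and $g$ is $\lambda$-strongly convex, and let $P(w)=\max_{\alpha\in\mathbb{R}^N}L(w,\alpha)$ and $D(\alpha)=\min_{w\in\mathbb{R}^d}L(w,\alpha)$ be the primal and dual functions. Let $\Lambda$ and $\Gamma$ be two constants that satisfy $$\Lambda\ge\|X_{ik}\|_F^2,\qquad i=1,\ldots,m,\quad k=1,\ldots,n,$$ and $$\Gamma \ge \max_{i,k}\left\{ \frac{1}{p_i}\left(1 + \frac{18\Lambda}{q_k \lambda\gamma_i}\right),\ \frac{1}{q_k}\left(1 + \frac{18n\Lambda}{p_i m\lambda\gamma_i}\right)\right\}.$$ In the DSCOVR-SVRG algorithm (described in the context), if we choose the step sizes as $$\sigma_i=\frac{1}{\gamma_i(p_i\Gamma-1)},\quad i=1,\ldots,m,\qquad \tau_k=\frac{1}{\lambda(q_k\Gamma-1)},\quad k=1,\ldots,n,$$ and the number of iterations during each stage satisfies $M\ge\log(3)\,\Gamma$, then for every stage index $s$, $$\mathbf{E}\left[P(\bar w^{(s)})-D(\bar\alpha^{(s)})\right]\le\left(\frac23\right)^s 2\Gamma\left(P(\bar w^{(0)})-D(\bar\alpha^{(0)})\right).$$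
   Context: Setting. $m,n,N_1,\ldots,N_m,d_1,\ldots,d_n$ are positive integers, $N=\sum_i N_i$, $d=\sum_k d_k$. Vectors $w\in\mathbb{R}^d$ are partitioned as $w=[w_1;\ldots;w_n]$ with $w_k\in\mathbb{R}^{d_k}$, and $\alpha\in\mathbb{R}^N$ as $\alpha=[\alpha_1;\ldots;\alpha_m]$ with $\alpha_i\in\mathbb{R}^{N_i}$. The matrix $X\in\mathbb{R}^{N\times d}$ is partitioned conformally into blocks $X_{ik}\in\mathbb{R}^{N_i\times d_k}$; $X_{i:}\in\mathbb{R}^{N_i\times d}$ denotes the $i$-th block row and $X_{:k}\in\mathbb{R}^{N\times d_k}$ the $k$-th block column. Given are functions $f_i:\mathbb{R}^{N_i}\to\mathbb{R}$ and $g(w)=\sum_{k=1}^n g_k(w_k)$ with $g_k:\mathbb{R}^{d_k}\to\mathbb{R}$, and constants $\lambda>0$, $\gamma_i>0$. $f_i^*(\alpha_i)=\sup_{u}\{\alpha_i^Tu-f_i(u)\}$ is the convex conjugate (similarly $g^*$), and $$L(w,\alpha)=\frac1m\sum_{i=1}^m\alpha_i^TX_{i:}w-\frac1m\sum_{i=1}^m f_i^*(\alpha_i)+g(w).$$ Explicitly, $P(w)=\frac1m\sum_i f_i(X_{i:}w)+g(w)$ and $D(\alpha)=-\frac1m\sum_i f_i^*(\alpha_i)-g^*\bigl(-\frac1m\sum_iX_{i:}^T\alpha_i\bigr)$. $\lambda$-strong convexity of $g$ means $g(w')\ge g(w)+\xi^T(w'-w)+\frac\lambda2\|w'-w\|^2$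 for all $w,w'$ and $\xi\in\partial g(w)$. Norms: $\|\cdot\|$ is the Euclidean norm for vectors, $\|\cdot\|_F$ the Frobenius norm. The proximal mapping is $\mathbf{prox}_\phi(v)=\arg\min_u\{\phi(u)+\frac12\|u-v\|^2\}$. $p=(p_1,\ldots,p_m)$ and $q=(q_1,\ldots,q_n)$ are probability distributions with all $p_i,q_k>0$; the step sizes $\sigma_i,\tau_k$ are understood to be positive finite numbers (i.e. $p_i\Gamma>1$, $q_k\Gamma>1$). DSCOVR-SVRG algorithm. Input: deterministic initial points $\bar w^{(0)}\in\mathbb{R}^d$, $\bar\alpha^{(0)}\in\mathbb{R}^N$, and the number $M$ (a positive integer) of iterations per stage. For each stage $s=0,1,2,\ldots$: set $\bar u^{(s)}=X\bar w^{(s)}$ and $\bar v^{(s)}=\frac1mX^T\bar\alpha^{(s)}$ (partitioned like $\alpha$ and $w$), $w^{(0)}=\bar w^{(s)}$, $\alpha^{(0)}=\bar\alpha^{(s)}$. For $t=0,\ldots,M-1$: pick $j\in\{1,\ldots,m\}$ with distribution $p$ and $l\in\{1,\ldots,n\}$ with distribution $q$, independently of each other and of the past; compute $$u_j^{(t+1)}=\bar u_j^{(s)}+\tfrac1{q_l}X_{jl}\bigl(w_l^{(t)}-\bar w_l^{(s)}\bigr),\qquad v_l^{(t+1)}=\bar v_l^{(s)}+\tfrac1{p_j}\tfrac1m X_{jl}^T\bigl(\alpha_j^{(t)}-\bar\alpha_j^{(s)}\bigr);$$ set $\alpha_j^{(t+1)}=\mathbf{prox}_{\sigma_jf_j^*}(\alpha_j^{(t)}+\sigma_ju_j^{(t+1)})$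 and $\alpha_i^{(t+1)}=\alpha_i^{(t)}$ for $i\ne j$; set $w_l^{(t+1)}=\mathbf{prox}_{\tau_lg_l}(w_l^{(t)}-\tau_lv_l^{(t+1)})$ and $w_k^{(t+1)}=w_k^{(t)}$ for $k\ne l$. At the end of the stage set $\bar w^{(s+1)}=w^{(M)}$, $\bar\alpha^{(s+1)}=\alpha^{(M)}$. The expectation $\mathbf{E}$ is over all random indices. *)

(* Defs.v *)
From HB Require Import structures.
From mathcomp Require Import all_boot all_order all_algebra finmap.
From mathcomp Require Import all_classical all_reals all_analysis.

Set Implicit Arguments.
Unset Strict Implicit.
Unset Printing Implicit Defensive.

Import Order.TTheory GRing.Theory Num.Theory.
Import numFieldNormedType.Exports.

Local Open Scope classical_set_scope.
Local Open Scope ring_scope.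

Definition dotv (R : realType) (n : nat) (u v : 'cV[R]_n) : R :=
  (u^T *m v) 0 0.

(* Frobenius norm, hence the Euclidean norm on column vectors; the library's
   `|A| on matrices is the max norm. *)
Definition fnorm (R : realType) (m n : nat) (A : 'M[R]_(m, n)) : R :=
  Num.sqrt (\sum_i \sum_j A i j ^+ 2).

Definition grad (R : realType) (n : nat) (f : 'cV[R]_n -> R) (x : 'cV[R]_n) :
    'cV[R]_n :=
  \col_i 'd f x (delta_mx i 0).

Definition lipschitz_grad (R : realType) (n : nat) (c : R)
    (f : 'cV[R]_n -> R) : Prop :=
  forall x y, fnorm (grad f x - grad f y) <= c * fnorm (x - y).

Definition subgradient (R : realType) (n : nat) (g : 'cV[R]_n -> R)
    (w xi : 'cV[R]_n) : Prop :=
  forall w', g w + dotv xi (w' - w) <= g w'.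

(* Convexity is a separate conjunct because the subgradient inequality alone
   holds vacuously for functions with no subgradient at all. *)
Definition strongly_convex (R : realType) (n : nat) (lambda : R)
    (g : 'cV[R]_n -> R) : Prop :=
  convex_function [set: 'cV[R]_n] g /\
  forall w w' xi, subgradient g w xi ->
    g w + dotv xi (w' - w) + lambda / 2 * fnorm (w' - w) ^+ 2 <= g w'.

Definition conjugate (R : realType) (n : nat) (f : 'cV[R]_n -> R)
    (a : 'cV[R]_n) : \bar R :=
  ereal_sup (range (fun u : 'cV[R]_n => (dotv a u - f u)%:E)).

(* The argmin is picked by choice; it is unique when phi is closed, proper and
   convex. *)
Definition prox (R : realType) (n : nat) (phi : 'cV[R]_n -> \bar R)
    (v : 'cV[R]_n) : 'cV[R]_n :=
  get [set u : 'cV[R]_n | forall u' : 'cV[R]_n,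
    (phi u + (2^-1 * fnorm (u - v) ^+ 2)%:E <=
     phi u' + (2^-1 * fnorm (u' - v) ^+ 2)%:E)%E].

(* Vectors of the product spaces are indexed by 'I_(\sum_i N i) and
   'I_(\sum_k d k), so that the library's submxcol, submxblock and \mxcol give
   the block decompositions: submxcol X i is the block row X_{i:}. *)
Section Problem.
Context (R : realType) (m n : nat) (N : 'I_m -> nat) (d : 'I_n -> nat).
Context (X : 'M[R]_(\sum_i N i, \sum_k d k)).
Context (f : forall i, 'cV[R]_(N i) -> R) (g : forall k, 'cV[R]_(d k) -> R).

Definition separable_sum (w : 'cV[R]_(\sum_k d k)) : R :=
  \sum_k g (submxcol w k).

Definition lagrangian (w : 'cV[R]_(\sum_k d k)) (a : 'cV[R]_(\sum_i N i)) :
    \bar R :=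
  ((m%:R^-1 * \sum_i dotv (submxcol a i) (submxcol X i *m w))%:E
   - (m%:R^-1)%:E * (\sum_i conjugate (@f i) (submxcol a i))
   + (separable_sum w)%:E)%E.

Definition primal (w : 'cV[R]_(\sum_k d k)) : \bar R :=
  ereal_sup (range (fun a => lagrangian w a)).

Definition dual (a : 'cV[R]_(\sum_i N i)) : \bar R :=
  ereal_inf (range (fun w => lagrangian w a)).

Context (p : 'I_m -> R) (q : 'I_n -> R) (sigma : 'I_m -> R) (tau : 'I_n -> R).

(* One inner iteration with snapshot (wbar, abar) and sampled blocks (j, l).
   The updated blocks are written with i and k, equal to j and l in their
   branches, so that dimensions match without casts. *)
Definition svrg_step (wbar : 'cV[R]_(\sum_k d k)) (abar : 'cV[R]_(\sum_i N i))
    (j : 'I_m) (l : 'I_n)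
    (z : 'cV[R]_(\sum_k d k) * 'cV[R]_(\sum_i N i)) :
    'cV[R]_(\sum_k d k) * 'cV[R]_(\sum_i N i) :=
  let w := z.1 in
  let a := z.2 in
  let ubar := X *m wbar in
  let vbar := m%:R^-1 *: (X^T *m abar) in
  let u i := submxcol ubar i +
    (q l)^-1 *: (submxblock X i l *m (submxcol w l - submxcol wbar l)) in
  let v k := submxcol vbar k +
    ((p j)^-1 * m%:R^-1) *:
      ((submxblock X j k)^T *m (submxcol a j - submxcol abar j)) in
  (\mxcol_k (if k == l
             then prox (fun x : 'cV[R]_(d k) => (tau k * g x)%:E)
                       (submxcol w k - tau k *: v k)
             else submxcol w k),
   \mxcol_i (if i == j
             then prox (fun x : 'cV[R]_(N i) =>
                          ((sigma i)%:E * conjugate (@f i) x)%E)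
                       (submxcol a i + sigma i *: u i)
             else submxcol a i)).

Fixpoint svrg_inner (wbar : 'cV[R]_(\sum_k d k)) (abar : 'cV[R]_(\sum_i N i))
    (j : nat -> 'I_m) (l : nat -> 'I_n) (t : nat) :
    'cV[R]_(\sum_k d k) * 'cV[R]_(\sum_i N i) :=
  if t is t'.+1
  then svrg_step wbar abar (j t') (l t') (svrg_inner wbar abar j l t')
  else (wbar, abar).

(* Iteration t of stage s consumes the draw number s * M + t. *)
Fixpoint svrg (M : nat) (w0 : 'cV[R]_(\sum_k d k)) (a0 : 'cV[R]_(\sum_i N i))
    (j : nat -> 'I_m) (l : nat -> 'I_n) (s : nat) :
    'cV[R]_(\sum_k d k) * 'cV[R]_(\sum_i N i) :=
  if s is s'.+1
  then let z := svrg M w0 a0 j l s' in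
       svrg_inner z.1 z.2 (fun t => j (s' * M + t)%N)
                          (fun t => l (s' * M + t)%N) M
  else (w0, a0).

End Problem.

Section Sampling.
Context (R : realType) (dd : measure_display) (Omega : measurableType dd).
Context (Pr : probability Omega R).

Definition mutually_independent (I : choiceType) (E : I -> set Omega) : Prop :=
  forall A : {fset I},
    Pr (\bigcap_(i in [set` A]) E i) =
    (\big[*%E/1%E]_(i <- enum_fset A) Pr (E i))%E.

(* All the variables J t and K t, t = 0, 1, ..., are mutually independent, each
   J t has law p and each K t has law q.  For variables with finitely many
   values, independence is the product rule for the events "= value". *)
Definition independent_draws (m n : nat) (p : 'I_m -> R) (q : 'I_n -> R)
    (J : nat -> Omega -> 'I_m) (K : nat -> Omega -> 'I_n) : Prop :=
  [/\ forall t i, measurable (J t @^-1` [set i]) /\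
                  Pr (J t @^-1` [set i]) = (p i)%:E,
      forall t k, measurable (K t @^-1` [set k]) /\
                  Pr (K t @^-1` [set k]) = (q k)%:E
    & forall (i : nat -> 'I_m) (k : nat -> 'I_n),
        mutually_independent (fun x : nat + nat =>
          match x with
          | inl t => J t @^-1` [set i t]
          | inr t => K t @^-1` [set k t]
          end)].

End Sampling.

(* Main.v *)
Require Import Defs.
From HB Require Import structures.
From mathcomp Require Import all_boot all_order all_algebra finmap.
From mathcomp Require Import all_classical all_reals all_analysis.
From mathcomp Require Import measurable_realfun ring lra.

Set Implicit Arguments.
Unset Strict Implicit.
Unset Printing Implicit Defensive.

Import Order.TTheory GRing.Theory Num.Theory.
Import numFieldNormedType.Exports.

Local Open Scope classical_set_scope.
Local Open Scope ring_scope.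

(** Let ws minimize the primal function and let as_i be the gradient of f_i at
    X_i ws, so that (ws, as) is a saddle point of L.  With the Bregman gaps
      A_i(a) = f_i^*(a) - f_i^*(as_i) - <a - as_i, X_i ws>,
      B_k(x) = g_k(x) - g_k(ws_k) + <x - ws_k, (X^T as)_k / m>,
    the Lyapunov function
      V(w, a) = 1/m sum_i (Gamma gamma_i / 2 |a_i - as_i|^2 + A_i(a_i) / p_i)
              + sum_k (Gamma lambda / 2 |w_k - ws_k|^2 + B_k(w_k) / q_k)
    satisfies E V(z') <= (1 - 8/(9 Gamma)) V(z) + V(zbar) / (9 Gamma) for one
    inner iteration with snapshot zbar: the strongly convex prox inequalities of
    the two updates are added, the coupling terms cancel in expectation, and the
    variance of the sampled directions is absorbed by the choice of Gamma.
    Iterating M times gives the factor 2/3 per stage.  Finally V lies between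
    P(w) - D(a) and 2 Gamma (P(w) - D(a)): the lower bound uses the smoothness
    of f_i and of g^*, the upper one the strong convexity of f_i^* and g. *)

(** The functions f_i^* may take the value +oo, so the estimates are confined to dual points where
    all of them are finite. Iterations stay there, because a dual prox point is a gradient value of
    f_i. A starting point outside makes the right-hand side +oo. The constant 18 comes from the
    noise. The second moment of a sampled direction carries a factor 2, which cancels the 1/2 of
    Young's inequality. The choice of Gamma then leaves lambda/18 |.|^2, that is 1/9 of the distance
    lambda/2 |.|^2, once for the iterate and once for the snapshot; the dual distances behave alike.
    As V is at least Gamma times the distance, the gain V/Gamma of a step loses V(z)/(9 Gamma), and
    V(zbar)/(9 Gamma) is added. The recursion has fixed point V(zbar)/8, well below the target 2/3
    V(zbar). No conditional expectation is needed: all averages are iterated finite sums over draws,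
    and one integral is converted into such a sum at the end. *)

Lemma addr_subl (V : zmodType) (x y : V) : x + y - x = y.
Proof. by rewrite addrAC subrr add0r. Qed.

(** * Euclidean vectors and their blocks *)

Section Vectors.
Context (R : realType).

Lemma dotvE n (u v : 'cV[R]_n) : dotv u v = \sum_i u i 0 * v i 0.
Proof. by rewrite /dotv mxE; apply: eq_bigr => i _; rewrite mxE. Qed.

Lemma dotvC n (u v : 'cV[R]_n) : dotv u v = dotv v u.
Proof. by rewrite !dotvE; apply: eq_bigr => i _; rewrite mulrC. Qed.

Lemma dotvDr n (u v w : 'cV[R]_n) : dotv u (v + w) = dotv u v + dotv u w.
Proof. by rewrite /dotv mulmxDr mxE. Qed.

Lemma dotvZr n c (u v : 'cV[R]_n) : dotv u (c *: v) = c * dotv u v.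
Proof. by rewrite /dotv -scalemxAr mxE. Qed.

Lemma dotvNr n (u v : 'cV[R]_n) : dotv u (- v) = - dotv u v.
Proof. by rewrite -scaleN1r dotvZr mulN1r. Qed.

Lemma dotvBr n (u v w : 'cV[R]_n) : dotv u (v - w) = dotv u v - dotv u w.
Proof. by rewrite dotvDr dotvNr. Qed.

Lemma dotvDl n (u v w : 'cV[R]_n) : dotv (u + v) w = dotv u w + dotv v w.
Proof. by rewrite dotvC dotvDr !(dotvC w). Qed.

Lemma dotvZl n c (u v : 'cV[R]_n) : dotv (c *: u) v = c * dotv u v.
Proof. by rewrite dotvC dotvZr dotvC. Qed.

Lemma dotvNl n (u v : 'cV[R]_n) : dotv (- u) v = - dotv u v.
Proof. by rewrite dotvC dotvNr dotvC. Qed.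

Lemma dotvBl n (u v w : 'cV[R]_n) : dotv (u - v) w = dotv u w - dotv v w.
Proof. by rewrite dotvDl dotvNl. Qed.

Lemma dotv0r n (u : 'cV[R]_n) : dotv u 0 = 0.
Proof. by rewrite -(scale0r 0) dotvZr mul0r. Qed.

Lemma dotv0l n (u : 'cV[R]_n) : dotv 0 u = 0.
Proof. by rewrite dotvC dotv0r. Qed.

Lemma dotv_sumr n (I : finType) (u : 'cV[R]_n) (F : I -> 'cV[R]_n) :
  dotv u (\sum_i F i) = \sum_i dotv u (F i).
Proof.
apply: (big_morph (dotv u)); last by rewrite dotv0r.
by move=> x y; rewrite dotvDr.
Qed.

Lemma dotv_trmx m n (A : 'M[R]_(m, n)) (u : 'cV[R]_m) (v : 'cV[R]_n) :
  dotv u (A *m v) = dotv (A^T *m u) v.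
Proof. by rewrite /dotv trmx_mul trmxK mulmxA. Qed.

Lemma fnorm_ge0 m n (A : 'M[R]_(m, n)) : 0 <= fnorm A.
Proof. exact: sqrtr_ge0. Qed.

Lemma fnorm_sqrE m n (A : 'M[R]_(m, n)) :
  fnorm A ^+ 2 = \sum_i \sum_j A i j ^+ 2.
Proof.
rewrite /fnorm sqr_sqrtr//; apply: sumr_ge0 => i _.
by apply: sumr_ge0 => j _; exact: sqr_ge0.
Qed.

Lemma fnorm_sqr n (u : 'cV[R]_n) : fnorm u ^+ 2 = dotv u u.
Proof.
rewrite fnorm_sqrE dotvE; apply: eq_bigr => i _.
by rewrite big_ord1 expr2.
Qed.

Lemma fnorm0_sqr n : fnorm (0 : 'cV[R]_n) ^+ 2 = 0.
Proof. by rewrite fnorm_sqr dotv0r. Qed.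

Lemma fnorm_sqr_le0 n (u : 'cV[R]_n) : fnorm u ^+ 2 <= 0 -> u = 0.
Proof.
have u0 : 0 <= fnorm u ^+ 2 by rewrite exprn_ge0// fnorm_ge0.
move=> u_le0; have /eqP : fnorm u ^+ 2 = 0 by apply/eqP; rewrite eq_le u_le0.
rewrite fnorm_sqrE psumr_eq0 => [/allP H0|i _]; last first.
  by apply: sumr_ge0 => j _; exact: sqr_ge0.
apply/matrixP => i j; move: (H0 i (mem_index_enum _)).
by rewrite big_ord1 sqrf_eq0 [j]ord1 => /eqP ->; rewrite mxE.
Qed.

Lemma dotvv_ge0 n (u : 'cV[R]_n) : 0 <= dotv u u.
Proof. by rewrite -fnorm_sqr exprn_ge0// fnorm_ge0. Qed.

Lemma fnormN n (u : 'cV[R]_n) : fnorm (- u) = fnorm u.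
Proof.
rewrite /fnorm; congr Num.sqrt; apply: eq_bigr => i _; apply: eq_bigr => j _.
by rewrite mxE sqrrN.
Qed.

Lemma fnormZ n c (u : 'cV[R]_n) : 0 <= c -> fnorm (c *: u) = c * fnorm u.
Proof.
move=> c0; apply/eqP; rewrite -(@eqrXn2 _ 2)// ?fnorm_ge0//; last first.
  by rewrite mulr_ge0// fnorm_ge0.
by rewrite exprMn !fnorm_sqr dotvZl dotvZr mulrA expr2.
Qed.

Lemma fnormD_sqr n (u v : 'cV[R]_n) :
  fnorm (u + v) ^+ 2 = fnorm u ^+ 2 + 2 * dotv u v + fnorm v ^+ 2.
Proof. by rewrite !fnorm_sqr dotvDl !dotvDr (dotvC v u); ring. Qed.

Lemma fnormB_sqr n (u v : 'cV[R]_n) :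
  fnorm (u - v) ^+ 2 = fnorm u ^+ 2 - 2 * dotv u v + fnorm v ^+ 2.
Proof. by rewrite fnormD_sqr fnormN dotvNr; ring. Qed.

Lemma fnormZ_sqr n c (u : 'cV[R]_n) :
  fnorm (c *: u) ^+ 2 = c ^+ 2 * fnorm u ^+ 2.
Proof. by rewrite !fnorm_sqr dotvZl dotvZr mulrA expr2. Qed.

Lemma dotv_young n c (u v : 'cV[R]_n) : 0 < c ->
  dotv u v <= c / 2 * fnorm u ^+ 2 + c^-1 / 2 * fnorm v ^+ 2.
Proof.
move=> c0; have := dotvv_ge0 (c *: u - v).
rewrite -fnorm_sqr fnormB_sqr fnormZ_sqr dotvZl => H.
rewrite -subr_ge0 -(pmulr_rge0 _ c0).
set U := fnorm u ^+ 2 in H *; set V := fnorm v ^+ 2 in H *.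
set D := dotv u v in H *.
have -> : c * (c / 2 * U + c^-1 / 2 * V - D) =
    (c ^+ 2 * U - 2 * (c * D) + V) / 2 by field; rewrite lt0r_neq0.
by rewrite divr_ge0.
Qed.

Lemma cauchy_schwarz n (u v : 'cV[R]_n) :
  dotv u v ^+ 2 <= fnorm u ^+ 2 * fnorm v ^+ 2.
Proof.
have := dotvv_ge0 (fnorm v ^+ 2 *: u - dotv u v *: v).
rewrite -fnorm_sqr fnormB_sqr !fnormZ_sqr dotvZl dotvZr.
have [v0 _|v0] := eqVneq (fnorm v ^+ 2) 0.
  suff -> : dotv u v = 0 by rewrite v0 expr0n mulr0.
  rewrite dotvE big1// => i _.
  move: v0; rewrite fnorm_sqr dotvE => /eqP.
  rewrite psumr_eq0; last by move=> k _; rewrite -expr2 sqr_ge0.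
  by move=> /allP /(_ i); rewrite mem_index_enum => /(_ isT) /=;
    rewrite mulf_eq0 orbb => /eqP ->; rewrite mulr0.
have {}v0 : 0 < fnorm v ^+ 2 by rewrite lt0r v0 exprn_ge0// fnorm_ge0.
move=> H; rewrite -subr_ge0 -(pmulr_rge0 _ v0); nra.
Qed.

Lemma dotv_le n (u v : 'cV[R]_n) : dotv u v <= fnorm u * fnorm v.
Proof.
have uv0 : 0 <= fnorm u * fnorm v by rewrite mulr_ge0// fnorm_ge0.
have [uv|/ltW uv] := leP (dotv u v) 0; first exact: le_trans uv _.
by rewrite -ler_sqr ?nnegrE// exprMn cauchy_schwarz.
Qed.

Lemma fnorm_mulmx m n (A : 'M[R]_(m, n)) (x : 'cV[R]_n) :
  fnorm (A *m x) ^+ 2 <= fnorm A ^+ 2 * fnorm x ^+ 2.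
Proof.
rewrite [leLHS]fnorm_sqrE (fnorm_sqrE A) mulr_suml; apply: ler_sum => i _.
have -> : \sum_j A i j ^+ 2 = fnorm (row i A)^T ^+ 2.
  by rewrite fnorm_sqr dotvE; apply: eq_bigr => j _; rewrite !mxE expr2.
rewrite big_ord1 (_ : (A *m x) i 0 = dotv (row i A)^T x) ?cauchy_schwarz//.
by rewrite mxE dotvE; apply: eq_bigr => j _; rewrite !mxE.
Qed.

Lemma fnorm_tr m n (A : 'M[R]_(m, n)) : fnorm A^T = fnorm A.
Proof.
rewrite /fnorm exchange_big/=; congr Num.sqrt.
by apply: eq_bigr => i _; apply: eq_bigr => j _; rewrite mxE.
Qed.

Lemma mx_norm_le_fnorm n (x : 'cV[R]_n) : `|x| <= fnorm x.
Proof.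
rewrite [leLHS]/Num.norm/= mx_normrE; apply/bigmax_leP; split=> [|[i j] _ /=].
  exact: fnorm_ge0.
rewrite -ler_sqr ?nnegrE ?fnorm_ge0// real_normK ?num_real// fnorm_sqrE.
rewrite (bigD1 i)//= (bigD1 j)//= -addrA lerDl addr_ge0 ?sumr_ge0// => k _.
  exact: sqr_ge0.
by apply: sumr_ge0 => l _; exact: sqr_ge0.
Qed.

Lemma dotv_block n (d : 'I_n -> nat) (x y : 'cV[R]_(\sum_k d k)) :
  dotv x y = \sum_k dotv (submxcol x k) (submxcol y k).
Proof.
rewrite -{1}(submxcolK x) -{1}(submxcolK y) /dotv tr_mxcol mul_mxrow_mxcol.
by rewrite summxE.
Qed.

Lemma fnorm_block n (d : 'I_n -> nat) (x : 'cV[R]_(\sum_k d k)) :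
  fnorm x ^+ 2 = \sum_k fnorm (submxcol x k) ^+ 2.
Proof.
by rewrite fnorm_sqr dotv_block; apply: eq_bigr => k _; rewrite fnorm_sqr.
Qed.

Lemma mulmx_blocks m n (N : 'I_m -> nat) (d : 'I_n -> nat)
    (X : 'M[R]_(\sum_i N i, \sum_k d k)) (w : 'cV[R]_(\sum_k d k)) i :
  submxcol X i *m w = \sum_k submxblock X i k *m submxcol w k.
Proof.
rewrite -{1}(submxcolK w) -{1}(submxrowK (submxcol X i)) mul_mxrow_mxcol.
by apply: eq_bigr => k _; rewrite submxblockEv.
Qed.

Lemma trmulmx_block m n (N : 'I_m -> nat) (d : 'I_n -> nat)
    (X : 'M[R]_(\sum_i N i, \sum_k d k)) (a : 'cV[R]_(\sum_i N i)) k :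
  submxcol (X^T *m a) k = \sum_i (submxblock X i k)^T *m submxcol a i.
Proof.
rewrite -submxcol_mul mulmx_blocks; apply: eq_bigr => i _.
by congr (_ *m _); apply/matrixP => u v; rewrite !mxE.
Qed.

Lemma submxcolZ n (d : 'I_n -> nat) c (x : 'cV[R]_(\sum_k d k)) k :
  submxcol (c *: x) k = c *: submxcol x k.
Proof. by apply/matrixP => u v; rewrite !mxE. Qed.

End Vectors.

(** * Finite convex functions *)

Section Convex.
Context (R : realType).

(** The weight is a plain real with two bounds, unlike in [convex_function], so that explicit
    weights and linear arithmetic apply directly. *)
Definition cvx n (h : 'cV[R]_n -> R) := forall t x y, 0 <= t -> t <= 1 ->
  h (t *: x + (1 - t) *: y) <= t * h x + (1 - t) * h y.

Lemma convex_function_cvx n (h : 'cV[R]_n -> R) :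
  convex_function [set: 'cV[R]_n] h -> cvx h.
Proof.
move=> ch t x y t0 t1.
by have := ch (Itv01 t0 t1) x y (in_setT _) (in_setT _).
Qed.

Lemma cvx_avg n (h : 'cV[R]_n -> R) k (x : nat -> 'cV[R]_n) : cvx h ->
  h (k.+1%:R^-1 *: \sum_(i < k.+1) x i) <= k.+1%:R^-1 * \sum_(i < k.+1) h (x i).
Proof.
move=> ch; elim: k => [|k IH]; first by rewrite !big_ord1 invr1 scale1r mul1r.
rewrite big_ord_recr [in leRHS]big_ord_recr/=.
set t : R := k.+1%:R / k.+2%:R.
have k1 : k.+1%:R != 0 :> R by rewrite pnatr_eq0.
have k2 : k.+2%:R != 0 :> R by rewrite pnatr_eq0.
have tE : 1 - t = k.+2%:R^-1.
  by rewrite /t -[k.+2]addn1 natrD; field; rewrite -natr1 in k2.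
have tk : t * k.+1%:R^-1 = k.+2%:R^-1 by rewrite /t mulrAC mulfV// mul1r.
set S := \sum_(i < k.+1) x i in IH *; set T := \sum_(i < k.+1) h (x i) in IH *.
have -> : k.+2%:R^-1 *: (S + x k.+1) =
    t *: (k.+1%:R^-1 *: S) + (1 - t) *: x k.+1.
  by rewrite scalerA tk tE scalerDr.
have t0 : 0 <= t by rewrite divr_ge0.
have t1 : t <= 1 by rewrite -subr_ge0 tE invr_ge0.
clearbody t; apply: le_trans (ch _ _ _ t0 t1) _.
by rewrite mulrDr tE lerD2r -tk -mulrA ler_wpM2l.
Qed.

(** The norm is the max norm. Radius 1/n keeps each n y_i in [-1, 1], where convexity on the segment
    from x - e_i to x + e_i bounds the increment along an axis. *)
Lemma cvx_upper_near n (h : 'cV[R]_n -> R) x : cvx h ->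
  exists2 C, 0 <= C & forall y, `|y| <= n%:R^-1 -> h (x + y) - h x <= C * `|y|.
Proof.
case: n h x => [|n] h x ch.
  exists 0 => // y _; rewrite mul0r.
  by rewrite (_ : x + y = x) ?subrr//; apply/matrixP => -[].
pose e (i : 'I_n.+1) : 'cV[R]_n.+1 := delta_mx i 0.
pose c i := `|h (x + e i) - h x| + `|h (x - e i) - h x|.
have c0 i : 0 <= c i by rewrite addr_ge0.
have he i s : `|s| <= 1 -> h (x + s *: e i) - h x <= `|s| * c i.
  move=> s1; have /orP[s0|s0] := le_total 0 s.
    rewrite ger0_norm// in s1 *.
    have := ch s (x + e i) x s0 s1.
    rewrite (_ : _ *: _ + _ = x + s *: e i); last first.
      by rewrite scalerDr addrAC -scalerDl subrKC scale1r.
    have : s * (h (x + e i) - h x) <= s * c i.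
      by rewrite ler_wpM2l// (le_trans (ler_norm _))// /c lerDl.
    lra.
  rewrite ler0_norm// in s1 *.
  have s0' : 0 <= - s by rewrite oppr_ge0.
  have := ch (- s) (x - e i) x s0' s1.
  rewrite (_ : _ *: _ + _ = x + s *: e i); last first.
    by apply/matrixP => a b; rewrite !mxE; ring.
  have : - s * (h (x - e i) - h x) <= - s * c i.
    by rewrite ler_wpM2l// (le_trans (ler_norm _))// /c lerDr.
  lra.
exists (\sum_i c i) => [|y yn]; first exact: sumr_ge0.
have yi i : `|y i 0| <= `|y|.
  rewrite [leRHS]/Num.norm/= mx_normrE; apply/bigmax_geP.
  by right; exists (i, 0).
have n0 : n.+1%:R != 0 :> R by rewrite pnatr_eq0.
(* x + y is the average of the points x + n y_i e_i. *)
pose z k := x + (n.+1%:R * y (inord k) 0) *: e (inord k).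
have -> : x + y = n.+1%:R^-1 *: \sum_(i < n.+1) z i.
  rewrite (eq_bigr (fun i => x + n.+1%:R *: (y i 0 *: e i))); last first.
    by move=> i _; rewrite /z inord_val scalerA.
  rewrite big_split/= sumr_const card_ord -scaler_sumr scalerDr scalerA.
  rewrite mulVf// scale1r -(scaler_nat n.+1 x) scalerA mulVf// scale1r.
  congr (_ + _).
  apply/matrixP => a b; rewrite summxE (bigD1 a)//= big1 ?addr0.
    by rewrite !mxE ord1 !eqxx mulr1.
  by move=> i ia; rewrite !mxE eq_sym (negbTE ia) mulr0.
apply: (@le_trans _ _ (n.+1%:R^-1 * \sum_(i < n.+1) (h (z i) - h x))).
  rewrite sumrB sumr_const card_ord mulrBr -[h x *+ _]mulr_natl.
  rewrite mulrA mulVf// mul1r.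
  by rewrite lerD2r; exact: cvx_avg.
rewrite mulr_sumr mulr_suml; apply: ler_sum => i _.
rewrite /z inord_val ler_pdivrMl//.
have nyi : `|n.+1%:R * y i 0| <= n.+1%:R * `|y|.
  by rewrite normrM ger0_norm// ler_wpM2l.
apply: le_trans (he _ _ _) _.
  by rewrite (le_trans nyi)// -ler_pdivlMl// mulr1.
by rewrite (mulrC (c i)) mulrA ler_wpM2r.
Qed.

(** Midpoint convexity, used to turn an upper bound at x - y into a lower bound at x + y. *)
Lemma cvx_sub_ge n (h : 'cV[R]_n -> R) x y : cvx h ->
  h x - h (x - y) <= h (x + y) - h x.
Proof.
move=> ch; have := ch 2^-1 (x + y) (x - y).
rewrite (_ : 1 - 2^-1 = 2^-1); last by field.
rewrite -scalerDr addrACA subrr addr0 -mulr2n -(scaler_nat 2 x) scalerA mulVf//.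
rewrite scale1r => /(_ ltac:(lra) ltac:(lra)); lra.
Qed.

Lemma cvx_lipschitz_near n (h : 'cV[R]_n -> R) x : cvx h ->
  exists2 C, 0 <= C &
    forall y, `|y| <= n%:R^-1 -> `|h (x + y) - h x| <= C * `|y|.
Proof.
move=> ch; have [C C0 hC] := cvx_upper_near x ch.
exists C => // y yn; rewrite ler_norml hC// andbT.
have := cvx_sub_ge x y ch; have := hC (- y).
by rewrite normrN => /(_ yn); lra.
Qed.

Lemma cvx_continuous n (h : 'cV[R]_n -> R) : cvx h -> continuous h.
Proof.
move=> ch x; have [C C0 hC] := cvx_lipschitz_near x ch.
have Fx := nbhs_filter x.
apply/cvgrPdist_le => e e0 /=.
(* In dimension 0 the radius [n%:R^-1] is 0 and gives no neighbourhood, but the space is a single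
   point. *)
case: n h x ch hC Fx => [|n] h x ch hC Fx.
  near=> t; rewrite (_ : t = x) ?subrr ?normr0 ?ltW//.
  by apply/matrixP => -[].
near=> t.
have tx : `|x - t| <= Num.min n.+1%:R^-1 (e / (C + 1)).
  near: t; apply: cvgr_dist_le; first exact: cvg_id.
  by rewrite lt_min invr_gt0 ltr0n/= divr_gt0// ltr_wpDl.
move: tx; rewrite le_min distrC => /andP[t1 t2].
rewrite distrC -{1}(subrKC x t) (le_trans (hC _ t1))//.
have C1 : 0 < C + 1 by rewrite ltr_wpDl.
move: t2; rewrite ler_pdivlMr// => t2.
have := normr_ge0 (t - x); nra.
Unshelve. all: by end_near. Qed.

(** A substitute for an affine minorant, available before any subgradient is known to exist. Far
    from x, convexity along the ray carries over the slope bound from the sphere of radius 1/n. *)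
Lemma cvx_lower_bound n (h : 'cV[R]_n -> R) x : cvx h ->
  exists2 C, 0 <= C & forall y, h x - C * `|y - x| <= h y.
Proof.
move=> ch; have [C C0 hC] := cvx_lipschitz_near x ch.
exists C => // z; rewrite -{2}(subrKC x z); move: (z - x) => {z} y.
have [y1|y1] := leP `|y| n%:R^-1.
  by have := hC _ y1; rewrite ler_norml => /andP[]; lra.
case: n h x ch hC y y1 => [|n] h x ch hC y y1.
  move: y1; rewrite (_ : y = 0) ?normr0 ?addr0 ?invr0 ?ltxx//.
  by apply/matrixP => -[].
have n0 : 0 < n.+1%:R^-1 :> R by rewrite invr_gt0.
have y0 : 0 < `|y| by exact: lt_trans y1.
pose s := n.+1%:R^-1 / `|y|.
have s0 : 0 < s by rewrite divr_gt0.
have s1 : s <= 1 by rewrite ler_pdivrMr// mul1r ltW.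
have ys : `|s *: y| = n.+1%:R^-1.
  by rewrite normrZ gtr0_norm// /s divfK// lt0r_neq0.
have := hC (s *: y); rewrite {1}ys lexx => /(_ isT).
rewrite normrZ (gtr0_norm s0) ler_norml => /andP[+ _].
have := ch s (x + y) x (ltW s0) s1.
rewrite (_ : _ *: _ + _ = x + s *: y); last first.
  by rewrite scalerDr addrAC -scalerDl subrKC scale1r.
move=> H1 H2; have : 0 <= s * (h (x + y) - h x + C * `|y|) by nra.
by rewrite pmulr_rge0//; lra.
Qed.

Lemma normr_tr m n (A : 'M[R]_(m, n)) : `|A^T| = `|A|.
Proof.
have H m' n' (B : 'M[R]_(m', n')) : `|B^T| <= `|B|.
  rewrite [leLHS]/Num.norm/= mx_normrE; apply/bigmax_leP; split=> [|[i j] _].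
    exact: normr_ge0.
  rewrite mxE [leRHS]/Num.norm/= mx_normrE; apply/bigmax_geP.
  by right; exists (j, i).
by apply/eqP; rewrite eq_le H -{1}(trmxK A) H.
Qed.

Lemma trmx_continuous m n : continuous (@trmx R m n).
Proof.
move=> A; have FA := nbhs_filter A; apply/cvgrPdist_le => e e0; near=> B.
rewrite -linearB/= normr_tr; near: B.
by apply: cvgr_dist_le => //; exact: cvg_id.
Unshelve. all: by end_near. Qed.

(** Beyond distance C / s the quadratic dominates the linear loss, so G is at least G c there, and a
    minimizer over the compact ball of that radius is global. *)
Lemma coercive_argmin n (G : 'cV[R]_n -> R) c C s : 0 < s -> continuous G ->
  (forall x, G c - C * `|x - c| + s * fnorm (x - c) ^+ 2 <= G x) ->
  exists y, forall u, G y <= G u.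
Proof.
move=> s0 cG Gc; pose r := Num.max 0 (C / s).
(* [bounded_closed_compact] speaks of row vectors, so the ball is transposed. *)
pose A := [set v : 'rV[R]_n | `|v^T - c| <= r].
have cA : compact A.
  apply: bounded_closed_compact.
    exists (r + `|c|); split=> [|M rM v vA /=]; first exact: num_real.
    rewrite (le_trans _ (ltW rM))// -(normr_tr v) -{1}(subrK c v^T).
    by rewrite (le_trans (ler_normD _ _))// lerD2r.
  rewrite (_ : A = (fun v : 'rV[R]_n => `|v^T - c|) @^-1` [set x | x <= r])//.
  apply: preimage_closed => [v _|]; last exact: closed_le.
  apply: (@continuous_comp _ _ _ (fun v : 'rV[R]_n => v^T - c) Num.norm).
    have Fv := nbhs_filter v.
    by apply: cvgB; [exact: trmx_continuous|exact: cvg_cst].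
  exact: norm_continuous.
have r0 : 0 <= r by rewrite le_max lexx.
have Ac : A c^T by rewrite /A/= trmxK subrr normr0.
have [||v vA vmin] := @compact_EVT_min _ R (G \o trmx) A _ cA.
- by exists c^T.
- apply: continuous_subspaceT => v.
  by apply: continuous_comp; [exact: trmx_continuous|exact: cG].
exists v^T => u.
have [ur|ur] := leP `|u - c| r.
  by have := vmin u^T; rewrite /= trmxK; apply; rewrite inE /A/= trmxK.
have := vmin c^T (mem_set Ac); rewrite /= trmxK => /le_trans; apply.
apply: le_trans (Gc u); move: ur; rewrite gt_max ltr_pdivrMr// => /andP[u0 Cu].
have : `|u - c| ^+ 2 <= fnorm (u - c) ^+ 2.
  by rewrite ler_sqr ?nnegrE ?fnorm_ge0// mx_norm_le_fnorm.
by nra.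
Qed.

Lemma cvxD n (h1 h2 : 'cV[R]_n -> R) : cvx h1 -> cvx h2 ->
  cvx (fun x => h1 x + h2 x).
Proof.
move=> c1 c2 t x y t0 t1.
by have := c1 t x y t0 t1; have := c2 t x y t0 t1; lra.
Qed.

Lemma cvxZ n c (h : 'cV[R]_n -> R) : 0 <= c -> cvx h -> cvx (fun x => c * h x).
Proof.
move=> c0 ch t x y t0 t1; have := ler_wpM2l c0 (ch t x y t0 t1); lra.
Qed.

Lemma cvx_sum n (I : finType) (h : I -> 'cV[R]_n -> R) :
  (forall i, cvx (h i)) -> cvx (fun x => \sum_i h i x).
Proof.
move=> ch t x y t0 t1; rewrite !mulr_sumr -big_split/=.
by apply: ler_sum => i _; exact: ch.
Qed.

Lemma cvx_mulmx m n (A : 'M[R]_(m, n)) (h : 'cV[R]_m -> R) :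
  cvx h -> cvx (fun x => h (A *m x)).
Proof.
by move=> ch t x y t0 t1; rewrite mulmxDr -!scalemxAr; exact: ch.
Qed.

Lemma cvx_dotv n (b c : 'cV[R]_n) : cvx (fun x => dotv b (x - c)).
Proof.
move=> t x y _ _; rewrite !dotvBr dotvDr !dotvZr.
by rewrite le_eqVlt; apply/orP; left; apply/eqP; ring.
Qed.

Lemma cvx_fnorm_sqr n (c : 'cV[R]_n) : cvx (fun x => fnorm (x - c) ^+ 2).
Proof.
move=> t x y t0 t1.
have -> : t *: x + (1 - t) *: y - c = t *: (x - c) + (1 - t) *: (y - c).
  rewrite !scalerBr addrACA -opprD -scalerDl (addrC t) subrK scale1r//.
move: (x - c) (y - c) => {}x {}y.
have := dotvv_ge0 (x - y); rewrite -fnorm_sqr fnormB_sqr fnormD_sqr.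
rewrite !fnormZ_sqr dotvZl dotvZr.
have : 0 <= t * (1 - t) by rewrite mulr_ge0// subr_ge0.
nra.
Qed.

Lemma prox_argmin n (h : 'cV[R]_n -> R) s c : 0 < s -> cvx h ->
  exists y, forall u,
    h y + s * fnorm (y - c) ^+ 2 <= h u + s * fnorm (u - c) ^+ 2.
Proof.
move=> s0 ch; have [C C0 hC] := cvx_lower_bound c ch.
apply: (@coercive_argmin _ _ c C s s0).
  apply: cvx_continuous; apply: cvxD => //.
  exact: cvxZ (ltW s0) (cvx_fnorm_sqr _).
by move=> x; rewrite subrr fnorm_sqr dotv0l mulr0 addr0 lerD2r.
Qed.

(** First-order optimality when q is only bounded above by a quadratic touching it at y: compare y
    with y + t (u - y), divide by t and let t tend to 0. One lemma thus serves prox objectives,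
    smooth functions and the primal problem. *)
Lemma argmin_subgradient n (h q : 'cV[R]_n -> R) y c C : cvx h ->
  (forall u, h y + q y <= h u + q u) ->
  (forall u, q u <= q y + dotv c (u - y) + C * fnorm (u - y) ^+ 2) ->
  subgradient h y (- c).
Proof.
move=> ch hmin qC u; rewrite dotvNl.
set D := dotv c (u - y); set V := fnorm (u - y) ^+ 2.
have H t : 0 < t -> t <= 1 -> 0 <= h u - h y + D + C * V * t.
  move=> t0 t1; rewrite -(pmulr_rge0 _ t0).
  have := ch t u y (ltW t0) t1; have := hmin (y + t *: (u - y)).
  have := qC (y + t *: (u - y)).
  rewrite (_ : y + t *: (u - y) - y = t *: (u - y)); last first.
    by rewrite addrAC subrr add0r.
  rewrite dotvZr fnormZ_sqr.
  rewrite -/D -/V (_ : t *: u + (1 - t) *: y = y + t *: (u - y)); first lra.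
  by rewrite scalerBl scale1r scalerBr addrCA.
rewrite -subr_ge0 (_ : _ - _ = h u - h y + D); last by ring.
rewrite leNgt; apply/negP => neg.
set a := h u - h y + D in H neg.
have CV : 0 <= C * V by have := H 1 ltr01 (lexx _); lra.
have d0 : 0 < C * V - a + 1 by lra.
(* An explicit t replaces the limit: it gives a + C V t = - t (1 - a), which is negative because a
   is. *)
pose t := - a / (C * V - a + 1).
have t0 : 0 < t by rewrite divr_gt0// oppr_gt0.
have t1 : t <= 1 by rewrite ler_pdivrMr//; lra.
have := H _ t0 t1.
have tE : t * (C * V - a + 1) = - a by rewrite /t divfK// lt0r_neq0.
have : 0 < t * (1 - a) by rewrite mulr_gt0//; lra.
nra.
Qed.

Lemma prox_subgradient n (h : 'cV[R]_n -> R) s c y : cvx h ->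
  (forall u, h y + s * fnorm (y - c) ^+ 2 <= h u + s * fnorm (u - c) ^+ 2) ->
  subgradient h y ((2 * s) *: (c - y)).
Proof.
move=> ch hmin.
have -> : (2 * s) *: (c - y) = - ((2 * s) *: (y - c)) by rewrite -scalerN opprB.
apply: (@argmin_subgradient _ _ (fun u => s * fnorm (u - c) ^+ 2) _ _ s) => //.
move=> u.
rewrite (_ : u - c = (y - c) + (u - y)); last by rewrite [RHS]addrC subrKA.
by rewrite fnormD_sqr dotvZl le_eqVlt; apply/orP; left; apply/eqP; ring.
Qed.

(** A prox point has a subgradient by optimality; finding one at some point avoids a separation
    theorem. *)
Lemma exists_subgradient n (h : 'cV[R]_n -> R) : cvx h ->
  exists y xi, subgradient h y xi.
Proof.
move=> ch; have [y hy] := prox_argmin 0 ltr01 ch.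
by exists y, ((2 * 1) *: (0 - y)); exact: prox_subgradient.
Qed.

End Convex.

(** * Smooth functions, conjugates and proximal steps *)

Section Smooth.
Context (R : realType).

Lemma dotv_grad n (f : 'cV[R]_n -> R) x v :
  differentiable f x -> dotv (grad f x) v = 'd f x v.
Proof.
move=> df; have {2}-> : v = \sum_i v i 0 *: delta_mx i 0.
  apply/matrixP => a b; rewrite summxE (bigD1 a)//= big1 ?addr0.
    by rewrite !mxE ord1 !eqxx mulr1.
  by move=> i ia; rewrite !mxE eq_sym (negbTE ia) mulr0.
rewrite dotvE linear_sum/=; apply: eq_bigr => i _.
by rewrite linearZ/= mxE mulrC.
Qed.

Lemma is_derive_line n (f : 'cV[R]_n -> R) (y v : 'cV[R]_n) (t : R) :
  differentiable f (y + t *: v) ->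
  is_derive t 1 (fun t => f (y + t *: v)) ('d f (y + t *: v) v).
Proof.
move=> df; have E : (fun h : R => h^-1 *:
      (((fun t => f (y + t *: v)) \o shift t) (h *: 1) - f (y + t *: v))) =
    (fun h : R => h^-1 *:
      ((f \o shift (y + t *: v)) (h *: v) - f (y + t *: v))).
  apply/funext => h /=; congr (_ *: (f _ - _)).
  by rewrite scalerDl addrCA [h *: 1]mulr1.
split; first by rewrite /derivable E; exact: diff_derivable.
by rewrite /derive E -deriveE.
Qed.

Lemma is_derive_quadratic (a b t : R) :
  is_derive t (1 : R) (a \*: id + b \*: (id * id) : R -> R) (a + 2 * b * t).
Proof.
have -> : a + 2 * b * t = a * 1 + b * (t * 1 + t * 1) by ring.
have dt := is_derive_id t (1 : R).
exact: is_deriveD (is_deriveZ a dt) (is_deriveZ b (is_deriveM dt dt)).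
Qed.

(* The gradient is an opaque function G, as unification would otherwise unfold
   [grad] down to the choice operator behind ['d]. *)
Definition smooth n (f : 'cV[R]_n -> R) (G : 'cV[R]_n -> 'cV[R]_n) c :=
  [/\ forall x, differentiable f x, forall x v, 'd f x v = dotv (G x) v &
      forall x y, fnorm (G x - G y) <= c * fnorm (x - y)].

Lemma smooth_grad n (f : 'cV[R]_n -> R) c :
  (forall x, differentiable f x) -> lipschitz_grad c f -> smooth f (grad f) c.
Proof. by move=> df lf; split=> // x v; rewrite dotv_grad. Qed.

Section Smooth_theory.
Context (n : nat) (f : 'cV[R]_n -> R) (G : 'cV[R]_n -> 'cV[R]_n) (c : R).
Hypothesis fG : smooth f G c.

Lemma dotv_lipschitz x y v :
  dotv (G x) v <= dotv (G y) v + c * fnorm (x - y) * fnorm v.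
Proof.
have [_ _ /(_ x y) xy] := fG.
rewrite -lerBlDl -dotvBl; apply: le_trans (dotv_le _ _) _.
by rewrite ler_wpM2r// fnorm_ge0.
Qed.

(** Subtract from t |-> f (y + t v) the quadratic [q] whose slope is the Lipschitz bound on the
    derivative. The difference has nonpositive derivative on the open unit interval, and the mean
    value theorem replaces integration. *)
Lemma descent y u :
  f u <= f y + dotv (G y) (u - y) + c / 2 * fnorm (u - y) ^+ 2.
Proof.
have [f_diff dfE _] := fG.
have -> : f u = f (y + 1 *: (u - y)) by rewrite scale1r subrKC.
move: (u - y) => v.
have lip t : 0 <= t ->
    dotv (G (y + t *: v)) v <= dotv (G y) v + c * fnorm v ^+ 2 * t.
  move=> t0; apply: le_trans (dotv_lipschitz _ y _) _.
  by rewrite (addr_subl y) fnormZ// lerD2l; lra.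
move: (dotv (G y) v) (fnorm v ^+ 2) lip => D V lip.
pose q : R -> R := D \*: id + (c / 2 * V) \*: (id * id).
pose psi : R -> R := (fun t => f (y + t *: v)) - q.
have dpsi (t : R) : is_derive t (1 : R) psi
    ('d f (y + t *: v) v - (D + 2 * (c / 2 * V) * t)).
  exact: is_deriveB (is_derive_line (f_diff _)) (is_derive_quadratic _ _ _).
have cpsi : {within `[0, 1], continuous psi}.
  apply: continuous_subspaceT => t; apply: differentiable_continuous.
  by apply/derivable1_diffP; have [] := dpsi t.
have [t /[!in_itv]/= /andP[t0 t1]] := MVT ltr01 (fun t _ => dpsi t) cpsi.
rewrite subr0 mulr1 dfE.
move: (lip t (ltW t0)); move: (dotv (G (y + t *: v)) v) => Dt.
rewrite /psi /q /= !fctE /= scale0r addr0 /GRing.scale/=.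
move: (f _) (f y) => fu fy; lra.
Qed.

(** Descent from u back to y costs c/2, and exchanging the gradient at u for the one at y costs c.
    The constant need not be sharp, since only the first-order part survives in
    [argmin_subgradient]. *)
Lemma descent_below y u :
  f y + dotv (G y) (u - y) - (3 * c / 2) * fnorm (u - y) ^+ 2 <= f u.
Proof.
rewrite -{3}(subrKC y u); move: (u - y) => v.
have := descent (y + v) y; have := dotv_lipschitz y (y + v) v; 
rewrite opprD addrA subrr add0r !fnormN !dotvNr.
move: (dotv (G (y + v)) v) (dotv (G y) v) (f (y + v)) (f y) => *.
by lra.
Qed.

Lemma subgradient_diff y : cvx f -> subgradient f y (G y).
Proof.
move=> cf; rewrite -(opprK (G y)).
apply: (@argmin_subgradient _ _ _
  (fun u => - dotv (G y) (u - y) + 3 * c / 2 * fnorm (u - y) ^+ 2)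
  _ _ (3 * c / 2)) => // u.
  by rewrite subrr dotv0r fnorm0_sqr; have := descent_below y u; lra.
by rewrite subrr dotv0r fnorm0_sqr dotvNl; lra.
Qed.

(** The roles in [argmin_subgradient] are exchanged: the linear function - <a, .> is the convex part
    and f the part bounded by a quadratic. Testing the outcome in direction a - G y gives |a - G
    y|^2 <= 0. *)
Lemma subgradient_eq_diff y a : subgradient f y a -> a = G y.
Proof.
move=> fa.
have ch : cvx (fun u => dotv (- a) (u - y)) by exact: cvx_dotv.
have /(_ (y + (a - G y))) : subgradient (fun u => dotv (- a) (u - y)) y
    (- G y).
  apply: (@argmin_subgradient _ _ _ f _ _ (c / 2)) => // u; last exact: descent.
  by rewrite subrr dotv0r dotvNl; have := fa u; lra.
rewrite subrr dotv0r (addr_subl y) add0r => H.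
apply/eqP; rewrite -subr_eq0; apply/eqP/fnorm_sqr_le0.
by rewrite fnorm_sqr {1}dotvBl; rewrite !dotvNl in H; lra.
Qed.

End Smooth_theory.

Lemma fenchel_young n (f : 'cV[R]_n -> R) a u :
  ((dotv a u - f u)%:E <= conjugate f a)%E.
Proof. by apply: ereal_sup_ubound; exists u. Qed.

Lemma conjugate_subgradient n (f : 'cV[R]_n -> R) y a :
  subgradient f y a -> conjugate f a = (dotv a y - f y)%:E.
Proof.
move=> fa; apply/eqP; rewrite eq_le fenchel_young andbT.
apply: ge_ereal_sup => _ [u _ <-]; rewrite lee_fin.
by have := fa u; rewrite dotvBr; lra.
Qed.

(** For convex f, <G y, y> - f y is the conjugate at G y and y a subgradient there, so this is
    strong convexity of the conjugate based at a gradient value. *)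
Lemma conjugate_strong n (f : 'cV[R]_n -> R) G gamma y b : 0 < gamma ->
  smooth f G (1 / gamma) ->
  ((dotv (G y) y - f y + dotv (b - G y) y +
    gamma / 2 * fnorm (b - G y) ^+ 2)%:E <= conjugate f b)%E.
Proof.
move=> g0 fG; set a := G y.
(* This point maximizes the lower bound that the descent lemma gives for
   <b, u> - f u. *)
apply: le_trans (fenchel_young f b (y + gamma *: (b - a))).
rewrite lee_fin; have := descent fG y (y + gamma *: (b - a)).
rewrite (addr_subl y) dotvZr fnormZ_sqr -/a.
have -> : 1 / gamma / 2 * (gamma ^+ 2 * fnorm (b - a) ^+ 2) =
    gamma / 2 * fnorm (b - a) ^+ 2 by field; rewrite lt0r_neq0.
have -> : dotv b (y + gamma *: (b - a)) =
    dotv a y + dotv (b - a) y +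
    gamma * (dotv a (b - a) + fnorm (b - a) ^+ 2).
  by rewrite fnorm_sqr -dotvDl subrKC dotvDr dotvZr dotvBl; ring.
by lra.
Qed.

(* Moreau's decomposition: the prox of the conjugate is read off a minimizer y
   of the finite convex function f + s/2 |. - v/s|^2, so that semicontinuity of
   the conjugate is never needed. *)
Lemma prox_conjugate n (f : 'cV[R]_n -> R) G gamma s v : 0 < gamma -> 0 < s ->
  cvx f -> smooth f G (1 / gamma) ->
  exists2 y, prox (fun x => (s%:E * conjugate f x)%E) v = G y &
    v = G y + s *: y.
Proof.
move=> g0 s0 cf fG.
have [y ymin] := prox_argmin (s^-1 *: v) (divr_gt0 s0 (ltr0n _ 2)) cf.
have fy := prox_subgradient cf ymin.
have := subgradient_eq_diff fG fy.
rewrite (_ : 2 * (s / 2) = s); last by field.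
rewrite scalerBr scalerA mulfV ?lt0r_neq0// scale1r => ay.
have vE : v = G y + s *: y by rewrite -ay subrK.
exists y => //; set a := G y in ay vE *.
have fa : conjugate f a = (dotv a y - f y)%:E.
  by apply: conjugate_subgradient; exact: (subgradient_diff fG).
(* The objective at b exceeds its value at [a] by at least |b - a|^2 / 2. This makes [a] a minimizer
   and the only one, so the choice in [prox] must return it. *)
have H b : ((s * (dotv a y - f y) + 2^-1 * fnorm (a - v) ^+ 2 +
    2^-1 * fnorm (b - a) ^+ 2)%:E <=
    s%:E * conjugate f b + (2^-1 * fnorm (b - v) ^+ 2)%:E)%E.
  have := conjugate_strong y b g0 fG; rewrite -/a.
  case: (conjugate f b) => [r| |] //; last first.
    by rewrite gt0_muley ?lte_fin// addye// ?leey.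
  rewrite -EFinM -EFinD !lee_fin => H.
  have := ler_wpM2l (ltW s0) H.
  have -> : b - v = (b - a) - s *: y by rewrite vE opprD addrA.
  have -> : a - v = - (s *: y) by rewrite vE opprD addrA subrr sub0r.
  rewrite fnormN (fnormB_sqr (b - a)) dotvZr.
  have : 0 <= s * (gamma / 2 * fnorm (b - a) ^+ 2).
    by rewrite !mulr_ge0 ?exprn_ge0 ?fnorm_ge0// ltW.
  by lra.
have uniq_a b : (forall b' : 'cV[R]_n,
    s%:E * conjugate f b + (2^-1 * fnorm (b - v) ^+ 2)%:E <=
    s%:E * conjugate f b' + (2^-1 * fnorm (b' - v) ^+ 2)%:E)%E -> b = a.
  move=> bmin; have := le_trans (H b) (bmin a).
  rewrite fa -EFinM -EFinD lee_fin gerDl pmulr_rle0// => ba.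
  by apply/eqP; rewrite -subr_eq0 (fnorm_sqr_le0 ba).
apply: get_subset1 => [b /=|b b' /= /uniq_a -> /uniq_a ->//].
rewrite fa -EFinM -EFinD; apply: le_trans (H b); rewrite lee_fin lerDl.
by rewrite mulr_ge0// exprn_ge0// fnorm_ge0.
Qed.

Lemma prox_real n (g : 'cV[R]_n -> R) t v : 0 < t -> cvx g ->
  let y := prox (fun x => (t * g x)%:E) v in subgradient g y (t^-1 *: (v - y)).
Proof.
move=> t0 cg; have half0 : 0 < 2^-1 :> R by rewrite invr_gt0.
have [z zmin] := prox_argmin v half0 (cvxZ (ltW t0) cg).
have := @getPex _ [set y : 'cV[R]_n | forall u : 'cV[R]_n,
    ((t * g y)%:E + (2^-1 * fnorm (y - v) ^+ 2)%:E <=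
     (t * g u)%:E + (2^-1 * fnorm (u - v) ^+ 2)%:E)%E].
rewrite -/(prox _ v); set y := prox _ v => /= ymin.
have H : subgradient (fun x => t * g x) y ((2 * 2^-1) *: (v - y)).
  apply: prox_subgradient (cvxZ (ltW t0) cg) _ => u.
  rewrite -lee_fin !EFinD; apply: ymin.
  by exists z => w; rewrite -!EFinD lee_fin.
move=> u; rewrite -(ler_pM2l t0) mulrDr dotvZl mulrA mulfV ?lt0r_neq0//.
by rewrite mul1r; have := H u; rewrite mulfV// scale1r.
Qed.

(** The three-point inequality of a prox step from x along u. The hypothesis is strong convexity at
    xt, with the prox residual as subgradient, tested at xs. *)
Lemma prox_ineq n (x xt xs u : 'cV[R]_n) s mu Ft Fs : 0 < s ->
  Ft + dotv (s^-1 *: (x + s *: u - xt)) (xs - xt) +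
    mu / 2 * fnorm (xs - xt) ^+ 2 <= Fs ->
  Ft - Fs - dotv (xt - xs) u + s^-1 / 2 * fnorm (xt - x) ^+ 2 +
    (s^-1 + mu) / 2 * fnorm (xt - xs) ^+ 2 <= s^-1 / 2 * fnorm (x - xs) ^+ 2.
Proof.
move=> s0; rewrite -(fnormN (xs - xt)) opprB.
have -> : dotv (s^-1 *: (x + s *: u - xt)) (xs - xt) =
    s^-1 * dotv (xt - x) (xt - xs) - dotv (xt - xs) u.
  rewrite (_ : s^-1 *: _ = - (s^-1 *: (xt - x)) + u); last first.
    rewrite addrAC scalerDr scalerA mulVf ?lt0r_neq0// scale1r.
    by rewrite -scalerN opprB.
  have -> : xt - xs = - (xs - xt) by rewrite opprB.
  move: (xs - xt) => w.
  by rewrite !(dotvDl, dotvNl, dotvNr, dotvZl) (dotvC u); ring.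
have -> : fnorm (x - xs) ^+ 2 = fnorm (xt - xs) ^+ 2 -
    2 * dotv (xt - x) (xt - xs) + fnorm (xt - x) ^+ 2.
  rewrite (_ : x - xs = (xt - xs) - (xt - x)); last first.
    by rewrite opprB [RHS]addrC subrKA.
  by rewrite fnormB_sqr (dotvC (xt - x)).
by lra.
Qed.

(* Young's inequality spends the whole proximal term |x~ - x|^2 on the noise
   u l - xi of the sampled direction. *)
Lemma block_descent n (L : finType) (om : L -> R) (x xs xi : 'cV[R]_n)
    (xt u : L -> 'cV[R]_n) (Bt : L -> R) (B p G mu s : R)
    (psi : 'cV[R]_n -> R -> R) :
  (forall y b, psi y b = G * mu / 2 * fnorm (y - xs) ^+ 2 + b / p) ->
  (forall l, 0 <= om l) -> \sum_l om l = 1 -> 0 < p -> 0 < mu -> 1 < p * G ->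
  0 <= B -> s = 1 / (mu * (p * G - 1)) ->
  (forall l, Bt l + dotv (xt l - xs) (xi - u l) +
    s^-1 / 2 * fnorm (xt l - x) ^+ 2 +
    (s^-1 + mu) / 2 * fnorm (xt l - xs) ^+ 2 <=
    s^-1 / 2 * fnorm (x - xs) ^+ 2) ->
  p * (\sum_l om l * psi (xt l) (Bt l)) + (1 - p) * psi x B <=
  (1 - G^-1) * psi x B + dotv (x - xs) (\sum_l om l *: u l - xi) +
  s / 2 * \sum_l om l * fnorm (u l - xi) ^+ 2.
Proof.
move=> psiE om0 om1 p0 mu0 pG B0 sE H.
have pG1 : 0 < p * G - 1 by rewrite subr_gt0.
have s0 : 0 < s by rewrite sE divr_gt0// mulr_gt0.
have G0 : 0 < G by rewrite -(pmulr_rgt0 _ p0) (lt_trans ltr01).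
have sV : s^-1 = mu * (p * G - 1) by rewrite sE div1r invrK.
set D := fnorm (x - xs) ^+ 2.
have Hl l : p * psi (xt l) (Bt l) <= s^-1 / 2 * D +
    dotv (x - xs) (u l - xi) + s / 2 * fnorm (u l - xi) ^+ 2.
  have := H l; rewrite -/D.
  have := @dotv_young _ _ s^-1 (xt l - x) (u l - xi).
  rewrite invr_gt0 invrK => /(_ s0).
  have -> : dotv (xt l - x) (u l - xi) =
      - dotv (xt l - xs) (xi - u l) - dotv (x - xs) (u l - xi).
    by rewrite -dotvNr opprB -dotvBl opprB addrA subrK.
  rewrite psiE mulrDr (mulrC p (_ / p)) divfK ?lt0r_neq0//.
  (* This identity dictates the step size: the prox inequality must yield p times the distance
     weight of [psi]. *)
  have -> : (s^-1 + mu) / 2 = p * (G * mu / 2) by rewrite sV; field.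
  by rewrite mulrA; lra.
have avg z : z = \sum_l om l * z by rewrite -mulr_suml om1 mul1r.
have -> : dotv (x - xs) (\sum_l om l *: u l - xi) =
    \sum_l om l * dotv (x - xs) (u l - xi).
  rewrite dotvBr dotv_sumr [dotv _ xi]avg -sumrB.
  by apply: eq_bigr => l _; rewrite dotvZr dotvBr mulrBr.
have : p * (\sum_l om l * psi (xt l) (Bt l)) <= s^-1 / 2 * D +
    \sum_l om l * dotv (x - xs) (u l - xi) +
    s / 2 * \sum_l om l * fnorm (u l - xi) ^+ 2.
  rewrite [s^-1 / 2 * D]avg !mulr_sumr -!big_split/=.
  apply: ler_sum => l _; rewrite mulrCA.
  by have := ler_wpM2l (om0 l) (Hl l); lra.
suff : s^-1 / 2 * D + (1 - p) * psi x B <= (1 - G^-1) * psi x B by lra.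
rewrite psiE -/D sV -subr_ge0.
(* The distance terms cancel exactly; only a nonnegative multiple of B remains. *)
have -> : (1 - G^-1) * (G * mu / 2 * D + B / p) -
    (mu * (p * G - 1) / 2 * D + (1 - p) * (G * mu / 2 * D + B / p)) =
    B * (p * G - 1) / (p * G) by field; rewrite !lt0r_neq0.
by rewrite divr_ge0 ?(ltW (mulr_gt0 p0 G0))// mulr_ge0// ltW.
Qed.

(** Split the vector into a_l / om_l and S - b_l / om_l, where S is the sum of the b_k, at the cost
    of a factor 2. The second part has mean 0, so its second moment is at most that of b_l / om_l.
    Pointwise, the surplus terms in [H] sum to - 2 |S|^2. *)
Lemma sampled_sqr_bound n (L : finType) (om : L -> R) (a b : L -> 'cV[R]_n) :
  (forall l, 0 < om l) -> \sum_l om l = 1 ->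
  \sum_l om l * fnorm (\sum_k b k + (om l)^-1 *: (a l - b l)) ^+ 2 <=
  2 * \sum_l (om l)^-1 * (fnorm (a l) ^+ 2 + fnorm (b l) ^+ 2).
Proof.
move=> om0 om1; set S := \sum_k b k.
have omV l : (om l)^-1 = om l * (om l)^-1 ^+ 2.
  by rewrite expr2 mulrA mulfV ?mul1r// lt0r_neq0.
have H l : om l * fnorm (S + (om l)^-1 *: (a l - b l)) ^+ 2 <=
    2 * ((om l)^-1 * (fnorm (a l) ^+ 2 + fnorm (b l) ^+ 2)) +
    (2 * fnorm S ^+ 2 * om l - 4 * dotv S (b l)).
  have -> : S + (om l)^-1 *: (a l - b l) =
      (om l)^-1 *: a l + (S - (om l)^-1 *: b l).
    by rewrite scalerBr addrCA.
  have := dotvv_ge0 ((om l)^-1 *: a l - (S - (om l)^-1 *: b l)).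
  rewrite -fnorm_sqr (fnormB_sqr ((om l)^-1 *: a l)).
  rewrite (fnormD_sqr ((om l)^-1 *: a l)) => /(ler_wpM2l (ltW (om0 l))).
  rewrite mulr0 (fnormB_sqr S) !fnormZ_sqr dotvZr => H1.
  have -> : (om l)^-1 * (fnorm (a l) ^+ 2 + fnorm (b l) ^+ 2) =
     om l * ((om l)^-1 ^+ 2 * fnorm (a l) ^+ 2) +
     om l * ((om l)^-1 ^+ 2 * fnorm (b l) ^+ 2).
    by rewrite {1}omV; ring.
  have : om l * ((om l)^-1 * dotv S (b l)) = dotv S (b l).
    by rewrite mulrA mulfV ?mul1r// lt0r_neq0.
  by lra.
apply: le_trans (ler_sum _ (fun l _ => H l)) _.
rewrite big_split/= -mulr_sumr gerDl sumrB -!mulr_sumr om1 -dotv_sumr -/S.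
by have := dotvv_ge0 S; rewrite fnorm_sqr; lra.
Qed.

(** Average |S - b_l / om_l|^2 >= 0 with the weights om_l. *)
Lemma weighted_sum_sqr n (L : finType) (om : L -> R) (b : L -> 'cV[R]_n) :
  (forall l, 0 < om l) -> \sum_l om l = 1 ->
  fnorm (\sum_l b l) ^+ 2 <= \sum_l (om l)^-1 * fnorm (b l) ^+ 2.
Proof.
move=> om0 om1; set S := \sum_l b l.
have H l : 2 * dotv S (b l) - om l * fnorm S ^+ 2 <=
    (om l)^-1 * fnorm (b l) ^+ 2.
  have := dotvv_ge0 (S - (om l)^-1 *: b l).
  rewrite -fnorm_sqr fnormB_sqr fnormZ_sqr dotvZr => /(ler_wpM2l (ltW (om0 l))).
  have : om l * ((om l)^-1 * dotv S (b l)) = dotv S (b l).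
    by rewrite mulrA mulfV ?mul1r// lt0r_neq0.
  have : om l * ((om l)^-1 ^+ 2 * fnorm (b l) ^+ 2) =
      (om l)^-1 * fnorm (b l) ^+ 2.
    by rewrite expr2 !mulrA mulfV ?mul1r// lt0r_neq0.
  by lra.
apply: le_trans (ler_sum _ (fun l _ => H l)).
rewrite sumrB -mulr_sumr -mulr_suml om1 -dotv_sumr -/S -fnorm_sqr.
by lra.
Qed.

(** Finiteness at the new point comes with the inequality: the prox point is a gradient value of f,
    where Fenchel's equality holds. *)
Lemma prox_conjugate_ineq n (f : 'cV[R]_n -> R) G gamma s x u xs :
  0 < gamma -> 0 < s -> cvx f -> smooth f G (1 / gamma) ->
  conjugate f xs \is a fin_num ->
  let xt := prox (fun x => (s%:E * conjugate f x)%E) (x + s *: u) in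
  conjugate f xt \is a fin_num /\
  fine (conjugate f xt) - fine (conjugate f xs) - dotv (xt - xs) u +
    s^-1 / 2 * fnorm (xt - x) ^+ 2 +
    (s^-1 + gamma) / 2 * fnorm (xt - xs) ^+ 2 <= s^-1 / 2 * fnorm (x - xs) ^+ 2.
Proof.
move=> g0 s0 cf fG xs_fin xt.
have [y xtE vE] := prox_conjugate (x + s *: u) g0 s0 cf fG.
rewrite -/xt in xtE.
have xtc : conjugate f xt = (dotv xt y - f y)%:E.
  by rewrite xtE; apply: conjugate_subgradient; exact: (subgradient_diff fG).
split; first by rewrite xtc.
apply: prox_ineq => //.
have := conjugate_strong y xs g0 fG.
rewrite -xtE -[conjugate f xs]fineK// lee_fin xtc/= => H; apply: le_trans H.
rewrite (dotvC _ (xs - xt)) (_ : s^-1 *: _ = y)//.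
by rewrite vE -xtE (addr_subl xt) scalerA mulVf ?scale1r// lt0r_neq0.
Qed.

End Smooth.

(** * Block structure and the saddle point *)

Section Blocks.
Context (R : realType) (n : nat) (d : 'I_n -> nat).
Implicit Types (w : 'cV[R]_(\sum_k d k)).

Definition set_block w k (x : 'cV[R]_(d k)) : 'cV[R]_(\sum_k d k) :=
  \mxcol_j @eqtype.dfwith _ (fun j => 'cV[R]_(d j)) (submxcol w) k x j.

Lemma set_block_eq w k (x : 'cV[R]_(d k)) : submxcol (set_block w x) k = x.
Proof. by rewrite mxcolK eqtype.dfwith_in. Qed.

Lemma set_block_neq w k (x : 'cV[R]_(d k)) j : j != k ->
  submxcol (set_block w x) j = submxcol w j.
Proof. by rewrite eq_sym => kj; rewrite mxcolK eqtype.dfwith_out. Qed.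

Lemma set_block_id w k : set_block w (submxcol w k) = w.
Proof.
apply/mxcolP => j; have [->|jk] := eqVneq j k; first by rewrite set_block_eq.
by rewrite set_block_neq.
Qed.

Lemma set_blockB w k (x y : 'cV[R]_(d k)) :
  set_block w x - set_block w y = set_block 0 (x - y).
Proof.
apply/mxcolP => j; rewrite submxcolB.
have [->|jk] := eqVneq j k; first by rewrite !set_block_eq.
by rewrite !set_block_neq// subrr submxcol0.
Qed.

Lemma dotv_set_block0 w k (x : 'cV[R]_(d k)) :
  dotv w (set_block 0 x) = dotv (submxcol w k) x.
Proof.
rewrite dotv_block (bigD1 k)//= set_block_eq big1 ?addr0// => j jk.
by rewrite set_block_neq// submxcol0 dotv0r.
Qed.

Context (g : forall k, 'cV[R]_(d k) -> R).

Lemma separable_sum_set_block w k (x : 'cV[R]_(d k)) :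
  separable_sum g (set_block w x) =
  g x + \sum_(j | j != k) g (submxcol w j).
Proof.
rewrite /separable_sum (bigD1 k)//= set_block_eq; congr (_ + _).
by apply: eq_bigr => j jk; rewrite set_block_neq.
Qed.

Lemma cvx_block k : cvx (separable_sum g) -> cvx (@g k).
Proof.
move=> cg t x y t0 t1.
have := cg t (set_block 0 x) (set_block 0 y) t0 t1.
have -> : t *: set_block 0 x + (1 - t) *: set_block 0 y =
    set_block 0 (t *: x + (1 - t) *: y).
  apply/mxcolP => j; rewrite submxcolD !submxcolZ.
  have [->|jk] := eqVneq j k; first by rewrite !set_block_eq.
  by rewrite !set_block_neq// submxcol0 !scaler0 addr0.
by rewrite !separable_sum_set_block; lra.
Qed.

Lemma subgradient_block w xi k : subgradient (separable_sum g) w xi ->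
  subgradient (@g k) (submxcol w k) (submxcol xi k).
Proof.
move=> gw x; have := gw (set_block w x).
rewrite -{1 3}(set_block_id w k) set_blockB dotv_set_block0.
by rewrite !separable_sum_set_block; lra.
Qed.

(* The other blocks are frozen at points where they have a subgradient, since
   strong convexity of the sum only speaks about its subgradients. *)
Lemma strongly_convex_block lambda k x xi x' :
  strongly_convex lambda (separable_sum g) -> subgradient (@g k) x xi ->
  g x + dotv xi (x' - x) + lambda / 2 * fnorm (x' - x) ^+ 2 <= g x'.
Proof.
move=> [/convex_function_cvx cg sg] gx.
have ex j : exists yz : 'cV[R]_(d j) * 'cV[R]_(d j),
    subgradient (@g j) yz.1 yz.2.
  have [y [z yz]] := exists_subgradient (cvx_block (k := j) cg).
  by exists (y, z).
pose y0 : 'cV[R]_(\sum_k d k) := \mxcol_j (projT1 (cid (ex j))).1.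
pose z0 : 'cV[R]_(\sum_k d k) := \mxcol_j (projT1 (cid (ex j))).2.
have /sg : subgradient (separable_sum g) (set_block y0 x) (set_block z0 xi).
  move=> w'; rewrite /separable_sum dotv_block -big_split/=.
  apply: ler_sum => j _; rewrite submxcolB.
  have [->|jk] := eqVneq j k; first by rewrite !set_block_eq; exact: gx.
  by rewrite !set_block_neq// !mxcolK; exact: (projT2 (cid (ex j))).
move=> /(_ (set_block y0 x')); rewrite !separable_sum_set_block set_blockB.
by rewrite fnorm_sqr !dotv_set_block0 !set_block_eq -fnorm_sqr; lra.
Qed.

End Blocks.

Section Saddle.
Context (R : realType) (m n : nat) (N : 'I_m -> nat) (d : 'I_n -> nat).
Context (m_gt0 : (0 < m)%N).
Context (X : 'M[R]_(\sum_i N i, \sum_k d k)).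
Context (f : forall i, 'cV[R]_(N i) -> R) (g : forall k, 'cV[R]_(d k) -> R).
Context (G : forall i, 'cV[R]_(N i) -> 'cV[R]_(N i)).
Context (lambda : R) (gamma : 'I_m -> R).
Hypothesis lambda_gt0 : 0 < lambda.
Hypothesis f_cvx : forall i, cvx (@f i).
Hypothesis f_smooth : forall i, smooth (@f i) (@G i) (1 / gamma i).
Hypothesis g_strong : strongly_convex lambda (separable_sum g).
Hypothesis gamma_gt0 : forall i, 0 < gamma i.

Lemma dotv_mulmx_block (a : 'cV[R]_(\sum_i N i)) (w : 'cV[R]_(\sum_k d k)) :
  dotv a (X *m w) = \sum_i dotv (submxcol a i) (submxcol X i *m w).
Proof. by rewrite dotv_block; apply: eq_bigr => i _; rewrite submxcol_mul. Qed.

Let q w := m%:R^-1 * \sum_i f (submxcol X i *m w).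

Let q_cvx : cvx q.
Proof.
apply: cvxZ; first by rewrite invr_ge0.
by apply: cvx_sum => i; exact: cvx_mulmx.
Qed.

Lemma exists_primal_argmin :
  exists w, forall u, separable_sum g w + q w <= separable_sum g u + q u.
Proof.
have [/convex_function_cvx g_cvx g_sub] := g_strong.
have [w1 [xi g1]] := exists_subgradient g_cvx.
(* Adding the linear term of the subgradient xi of g to the loss leaves a single linear lower bound,
   against which the quadratic from strong convexity wins. *)
have [C C0 hC] := cvx_lower_bound w1 (cvxD q_cvx (cvx_dotv xi w1)).
apply: (@coercive_argmin _ _ _ w1 C (lambda / 2)).
- by rewrite divr_gt0.
- exact: cvx_continuous (cvxD g_cvx q_cvx).
move=> x; have := g_sub _ x _ g1; have := hC x; rewrite subrr dotv0r.
move: (dotv xi _) (q x) (q w1) (fnorm _ ^+ 2) (separable_sum g x)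
  (separable_sum g w1) `|_| => *; lra.
Qed.

(** Optimality of a primal minimizer: the loss lies below its linearization plus a quadratic by the
    descent lemma, so minus its gradient is a subgradient of g. *)
Lemma exists_saddle_point : exists w, subgradient (separable_sum g) w
  (- (m%:R^-1 *: (X^T *m \mxcol_i G (submxcol X i *m w)))).
Proof.
have [w w_min] := exists_primal_argmin.
have [/convex_function_cvx g_cvx _] := g_strong.
exists w; set a := \mxcol_i _.
apply: (@argmin_subgradient _ _ _ q w _
  (m%:R^-1 * \sum_i (1 / gamma i / 2 * fnorm (submxcol X i) ^+ 2)) g_cvx) => //.
move=> u.
rewrite dotvZl -dotv_trmx dotv_mulmx_block /q -!mulrA -!mulrDr.
rewrite mulr_suml -!big_split/= ler_wpM2l ?invr_ge0//; apply: ler_sum => i _.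
rewrite mxcolK mulmxBr.
apply: le_trans (descent (f_smooth i) (submxcol X i *m w) _) _.
rewrite lerD2l -mulmxBr -[leRHS]mulrA ler_wpM2l ?fnorm_mulmx//.
by rewrite !divr_ge0// ltW.
Qed.

End Saddle.

(** * Expected decrease of the Lyapunov function *)

Lemma sum_pick (R : realType) (I L : finType) (P : I -> R) (Q : L -> R) i
    (F : L -> R) c : \sum_j P j = 1 -> \sum_l Q l = 1 ->
  \sum_j \sum_l P j * Q l * (if i == j then F l else c) =
  P i * (\sum_l Q l * F l) + (1 - P i) * c.
Proof.
move=> P1 Q1; rewrite (bigD1 i)//= eqxx mulr_sumr; congr (_ + _).
  by apply: eq_bigr => l _; rewrite mulrA.
have -> : 1 - P i = \sum_(j | j != i) P j.
  by rewrite -P1 (bigD1 i)//= addr_subl.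
rewrite mulr_suml; apply: eq_bigr => j ji.
rewrite eq_sym (negbTE ji) -[RHS]mulr1 -Q1 mulr_sumr; apply: eq_bigr => l _.
by rewrite mulrAC.
Qed.

Lemma weight_le1 (R : realType) (I : finType) (w : I -> R) i :
  (forall i, 0 < w i) -> \sum_i w i = 1 -> w i <= 1.
Proof.
move=> w_gt0 <-; rewrite (bigD1 i)//= lerDl sumr_ge0// => j _.
by rewrite ltW.
Qed.

Section Descent.
Context (R : realType) (m n : nat) (N : 'I_m -> nat) (d : 'I_n -> nat).
Context (m_gt0 : (0 < m)%N) (n_gt0 : (0 < n)%N).
Context (X : 'M[R]_(\sum_i N i, \sum_k d k)).
Context (f : forall i, 'cV[R]_(N i) -> R) (g : forall k, 'cV[R]_(d k) -> R).
Context (G : forall i, 'cV[R]_(N i) -> 'cV[R]_(N i)).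
Context (lambda : R) (gamma : 'I_m -> R).
Hypothesis lambda_gt0 : 0 < lambda.
Hypothesis gamma_gt0 : forall i, 0 < gamma i.
Hypothesis f_cvx : forall i, cvx (@f i).
Hypothesis f_smooth : forall i, smooth (@f i) (@G i) (1 / gamma i).
Hypothesis g_strong : strongly_convex lambda (separable_sum g).
Context (p : 'I_m -> R) (q : 'I_n -> R).
Hypotheses (p_gt0 : forall i, 0 < p i) (p_sum1 : \sum_i p i = 1).
Hypotheses (q_gt0 : forall k, 0 < q k) (q_sum1 : \sum_k q k = 1).
Context (Lambda Gamma : R).
Hypothesis Lambda_ge : forall i k, fnorm (submxblock X i k) ^+ 2 <= Lambda.
Hypothesis Gamma_ge : forall i k,
  1 / p i * (1 + 18 * Lambda / (q k * lambda * gamma i)) <= Gamma /\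
  1 / q k * (1 + 18 * n%:R * Lambda / (p i * m%:R * lambda * gamma i)) <= Gamma.
Hypothesis pGamma_gt1 : forall i, 1 < p i * Gamma.
Hypothesis qGamma_gt1 : forall k, 1 < q k * Gamma.
Context (sigma : 'I_m -> R) (tau : 'I_n -> R).
Hypothesis sigmaE : forall i, sigma i = 1 / (gamma i * (p i * Gamma - 1)).
Hypothesis tauE : forall k, tau k = 1 / (lambda * (q k * Gamma - 1)).

Context (ws : 'cV[R]_(\sum_k d k)).
Let as_ : 'cV[R]_(\sum_i N i) := \mxcol_i G (submxcol X i *m ws).
Let xi : 'cV[R]_(\sum_k d k) := - (m%:R^-1 *: (X^T *m as_)).
Hypothesis ws_opt : subgradient (separable_sum g) ws xi.

Let m0 : 0 < m%:R :> R. Proof. by rewrite ltr0n. Qed.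
Let n0 : 0 < n%:R :> R. Proof. by rewrite ltr0n. Qed.

Lemma Gamma_gt0 : 0 < Gamma.
Proof.
rewrite -(pmulr_rgt0 _ (p_gt0 (Ordinal m_gt0))).
exact: lt_trans (pGamma_gt1 _).
Qed.

Lemma sigma_gt0 i : 0 < sigma i.
Proof. by rewrite sigmaE divr_gt0// mulr_gt0// subr_gt0. Qed.

Lemma tau_gt0 k : 0 < tau k.
Proof. by rewrite tauE divr_gt0// mulr_gt0// subr_gt0. Qed.

(** The first bound on Gamma, cleared of denominators so that 1 / sigma_i appears on the right. *)
Lemma Lambda_q_le i k :
  (q k)^-1 * Lambda <= lambda / 18 * (gamma i * (p i * Gamma - 1)).
Proof.
have [+ _] := Gamma_ge i k.
rewrite mulrAC mul1r ler_pdivrMr// (mulrC Gamma) -lerBrDl.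
rewrite ler_pdivrMr ?mulr_gt0// => H.
rewrite mulrC ler_pdivrMr//; nra.
Qed.

Lemma Lambda_p_le i k :
  (p i)^-1 * (m%:R^-1 * Lambda) <=
  gamma i / (18 * n%:R) * (lambda * (q k * Gamma - 1)).
Proof.
have [_] := Gamma_ge i k.
rewrite mulrAC mul1r ler_pdivrMr// (mulrC Gamma) -lerBrDl.
rewrite ler_pdivrMr ?mulr_gt0// => H.
rewrite mulrCA ler_pdivrMl// mulrC ler_pdivrMr//.
rewrite -(ler_pM2l (_ : 0 < 18 * n%:R)) ?mulr_gt0//.
have -> : 18 * n%:R * (m%:R * (gamma i / (18 * n%:R) *
    (lambda * (q k * Gamma - 1))) * p i) =
    m%:R * gamma i * lambda * (q k * Gamma - 1) * p i.
  by field; rewrite lt0r_neq0.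
by lra.
Qed.

Lemma sigma_Lambda_le i k : sigma i * ((q k)^-1 * Lambda) <= lambda / 18.
Proof.
by rewrite sigmaE mulrAC ler_pdivrMr ?mul1r ?Lambda_q_le// mulr_gt0// subr_gt0.
Qed.

Lemma tau_Lambda_le i k :
  tau k * ((p i)^-1 * (m%:R^-1 * Lambda)) <= gamma i / (18 * n%:R).
Proof.
by rewrite tauE mulrAC ler_pdivrMr ?mul1r ?Lambda_p_le// mulr_gt0// subr_gt0.
Qed.

Lemma fnorm_mul_block i k (x : 'cV[R]_(d k)) :
  fnorm (submxblock X i k *m x) ^+ 2 <= Lambda * fnorm x ^+ 2.
Proof.
apply: le_trans (fnorm_mulmx _ _) _.
by rewrite ler_wpM2r// exprn_ge0// fnorm_ge0.
Qed.

Lemma fnorm_tr_mul_block i k (x : 'cV[R]_(N i)) :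
  fnorm ((submxblock X i k)^T *m x) ^+ 2 <= Lambda * fnorm x ^+ 2.
Proof.
apply: le_trans (fnorm_mulmx _ _) _.
by rewrite fnorm_tr ler_wpM2r// exprn_ge0// fnorm_ge0.
Qed.

(** [fine] sends an infinite conjugate to 0, so this is the Bregman gap only at points of finite
    conjugate, a property that iterations preserve. *)
Definition breg_f i (a : 'cV[R]_(N i)) :=
  fine (conjugate (@f i) a) - fine (conjugate (@f i) (submxcol as_ i)) -
  dotv (a - submxcol as_ i) (submxcol X i *m ws).

Definition breg_g k (x : 'cV[R]_(d k)) :=
  g x - g (submxcol ws k) - dotv (x - submxcol ws k) (submxcol xi k).

(** Block i moves only with probability p_i; dividing b by p_i compensates for this, so that the
    expected step contains b with coefficient 1. *)
Definition psi_f i (a : 'cV[R]_(N i)) b :=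
  Gamma * gamma i / 2 * fnorm (a - submxcol as_ i) ^+ 2 + b / p i.

Definition psi_g k (x : 'cV[R]_(d k)) b :=
  Gamma * lambda / 2 * fnorm (x - submxcol ws k) ^+ 2 + b / q k.

Lemma conjugate_as i : conjugate (@f i) (submxcol as_ i) =
  (dotv (submxcol as_ i) (submxcol X i *m ws) - f (submxcol X i *m ws))%:E.
Proof.
rewrite mxcolK; apply: conjugate_subgradient.
exact: (subgradient_diff (f_smooth i)).
Qed.

Lemma breg_f_ge i (a : 'cV[R]_(N i)) : conjugate (@f i) a \is a fin_num ->
  gamma i / 2 * fnorm (a - submxcol as_ i) ^+ 2 <= breg_f a.
Proof.
move=> a_fin.
have := conjugate_strong (submxcol X i *m ws) a (gamma_gt0 i) (f_smooth i).
rewrite -[conjugate (@f i) a]fineK// lee_fin /breg_f conjugate_as/= mxcolK.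
by lra.
Qed.

Lemma breg_f_ge0 i (a : 'cV[R]_(N i)) : conjugate (@f i) a \is a fin_num ->
  0 <= breg_f a.
Proof.
move=> /breg_f_ge; apply: le_trans.
by rewrite mulr_ge0 ?exprn_ge0 ?fnorm_ge0// divr_ge0// ltW.
Qed.

Lemma breg_g_ge k (x : 'cV[R]_(d k)) :
  lambda / 2 * fnorm (x - submxcol ws k) ^+ 2 <= breg_g x.
Proof.
have := strongly_convex_block x g_strong (subgradient_block (k := k) ws_opt).
by rewrite /breg_g (dotvC (x - _)); lra.
Qed.

Lemma breg_g_ge0 k (x : 'cV[R]_(d k)) : 0 <= breg_g x.
Proof.
apply: le_trans (breg_g_ge x).
by rewrite mulr_ge0 ?exprn_ge0 ?fnorm_ge0// divr_ge0// ltW.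
Qed.

Lemma descent_f i (a : 'cV[R]_(N i)) (u at_ : 'I_n -> 'cV[R]_(N i)) :
  conjugate (@f i) a \is a fin_num ->
  (forall l, at_ l = prox (fun x => ((sigma i)%:E * conjugate (@f i) x)%E)
                          (a + sigma i *: u l)) ->
  p i * (\sum_l q l * psi_f (at_ l) (breg_f (at_ l))) +
    (1 - p i) * psi_f a (breg_f a) <=
  (1 - Gamma^-1) * psi_f a (breg_f a) +
  dotv (a - submxcol as_ i) (\sum_l q l *: u l - submxcol X i *m ws) +
  sigma i / 2 * \sum_l q l * fnorm (u l - submxcol X i *m ws) ^+ 2.
Proof.
move=> a_fin atE.
apply: (block_descent (psi := @psi_f i) (xt := at_) (mu := gamma i)) => //.
- by move=> l; exact: ltW.
- exact: breg_f_ge0.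
move=> l; have as_fin : conjugate (@f i) (submxcol as_ i) \is a fin_num.
  by rewrite conjugate_as.
have [_] := prox_conjugate_ineq a (u l) (gamma_gt0 i) (sigma_gt0 i) (@f_cvx i)
  (f_smooth i) as_fin.
by rewrite -atE /breg_f dotvBr; lra.
Qed.

Lemma descent_g k (x : 'cV[R]_(d k)) (v xt : 'I_m -> 'cV[R]_(d k)) :
  (forall j, xt j = prox (fun x => (tau k * g x)%:E) (x - tau k *: v j)) ->
  q k * (\sum_j p j * psi_g (xt j) (breg_g (xt j))) +
    (1 - q k) * psi_g x (breg_g x) <=
  (1 - Gamma^-1) * psi_g x (breg_g x) +
  dotv (x - submxcol ws k) (\sum_j p j *: - v j - submxcol xi k) +
  tau k / 2 * \sum_j p j * fnorm (- v j - submxcol xi k) ^+ 2.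
Proof.
move=> xtE.
apply: (block_descent (psi := @psi_g k) (xt := xt) (mu := lambda)) => //.
- by move=> j; exact: ltW.
- exact: breg_g_ge0.
move=> j; have [/convex_function_cvx cg _] := g_strong.
have gx := prox_real (x - tau k *: v j) (tau_gt0 k) (cvx_block (k := k) cg).
rewrite -xtE in gx.
have := strongly_convex_block (submxcol ws k) g_strong gx.
rewrite -scalerN => /(prox_ineq (tau_gt0 k)).
by rewrite /breg_g dotvBr; lra.
Qed.

(** * Mean and second moment of the sampled directions *)

Lemma sampled_mean_f i (w wb : 'cV[R]_(\sum_k d k)) :
  \sum_l q l *: (submxcol (X *m wb) i + (q l)^-1 *:
    (submxblock X i l *m (submxcol w l - submxcol wb l))) = submxcol X i *m w.
Proof.
have E l : q l *: (submxcol (X *m wb) i + (q l)^-1 *: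
    (submxblock X i l *m (submxcol w l - submxcol wb l))) =
    q l *: submxcol (X *m wb) i + (submxblock X i l *m submxcol w l -
      submxblock X i l *m submxcol wb l).
  by rewrite scalerDr scalerA mulfV ?lt0r_neq0// scale1r mulmxBr.
rewrite (eq_bigr _ (fun l _ => E l)) big_split/= -scaler_suml q_sum1 scale1r.
by rewrite sumrB -!mulmx_blocks -submxcol_mul subrKC.
Qed.

Lemma sampled_mean_g k (a ab : 'cV[R]_(\sum_i N i)) :
  \sum_j p j *: - (submxcol (m%:R^-1 *: (X^T *m ab)) k +
    ((p j)^-1 * m%:R^-1) *:
      ((submxblock X j k)^T *m (submxcol a j - submxcol ab j))) =
  - submxcol (m%:R^-1 *: (X^T *m a)) k.
Proof.
have E j : p j *: - (submxcol (m%:R^-1 *: (X^T *m ab)) k +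
    ((p j)^-1 * m%:R^-1) *:
      ((submxblock X j k)^T *m (submxcol a j - submxcol ab j))) =
    p j *: - submxcol (m%:R^-1 *: (X^T *m ab)) k +
    - m%:R^-1 *: ((submxblock X j k)^T *m submxcol a j -
                (submxblock X j k)^T *m submxcol ab j).
  rewrite opprD scalerDr -[- (_ *: _)]scaleNr scalerA mulrN mulrA.
  by rewrite mulfV ?lt0r_neq0// mul1r mulmxBr.
rewrite (eq_bigr _ (fun j _ => E j)) big_split/= -scaler_suml p_sum1 scale1r.
rewrite -scaler_sumr sumrB -!trmulmx_block !submxcolZ scaleNr -opprD scalerBr.
by rewrite subrKC.
Qed.

(** Recentred at ws, the direction error has the form of [sampled_sqr_bound], with a from the
    iterate and b from the snapshot; sigma_i Lambda / q_l <= lambda / 18 does the rest. *)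
Lemma sampled_noise_f i (w wb : 'cV[R]_(\sum_k d k)) :
  sigma i / 2 * \sum_l q l * fnorm (submxcol (X *m wb) i + (q l)^-1 *:
    (submxblock X i l *m (submxcol w l - submxcol wb l)) -
    submxcol X i *m ws) ^+ 2 <=
  lambda / 18 * (fnorm (w - ws) ^+ 2 + fnorm (wb - ws) ^+ 2).
Proof.
pose b l := submxblock X i l *m submxcol (wb - ws) l.
pose a l := submxblock X i l *m submxcol (w - ws) l.
have E l : submxcol (X *m wb) i + (q l)^-1 *:
      (submxblock X i l *m (submxcol w l - submxcol wb l)) -
      submxcol X i *m ws = \sum_k b k + (q l)^-1 *: (a l - b l).
  rewrite /b -mulmx_blocks (mulmxBr (submxcol X i)) -submxcol_mul addrAC.
  congr (_ + _ *: _).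
  by rewrite /a -mulmxBr !submxcolB opprB addrA subrK.
rewrite (eq_bigr _ (fun l _ => congr1 (fun y => q l * fnorm y ^+ 2) (E l))).
apply: le_trans (ler_wpM2l _ (sampled_sqr_bound a b q_gt0 q_sum1)) _.
  by rewrite divr_ge0// ltW// sigma_gt0.
rewrite mulrA divfK// mulr_sumr !fnorm_block -big_split/= mulr_sumr.
apply: ler_sum => l _.
have aL : fnorm (a l) ^+ 2 <= Lambda * fnorm (submxcol (w - ws) l) ^+ 2.
  exact: fnorm_mul_block.
have bL : fnorm (b l) ^+ 2 <= Lambda * fnorm (submxcol (wb - ws) l) ^+ 2.
  exact: fnorm_mul_block.
apply: (@le_trans _ _ (sigma i * ((q l)^-1 * (Lambda *
    (fnorm (submxcol (w - ws) l) ^+ 2 + fnorm (submxcol (wb - ws) l) ^+ 2))))).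
  rewrite ler_wpM2l ?(ltW (sigma_gt0 i))//.
  rewrite ler_wpM2l ?invr_ge0 ?(ltW (q_gt0 l))//.
  by rewrite mulrDr lerD.
rewrite (mulrA _ Lambda) mulrA ler_wpM2r ?sigma_Lambda_le//.
by rewrite addr_ge0// exprn_ge0// fnorm_ge0.
Qed.

(** The bound does not depend on k and is later summed over all n primal blocks, whereas dual blocks
    are averaged. This is why the second bound on Gamma contains n. *)
Lemma sampled_noise_g k (a ab : 'cV[R]_(\sum_i N i)) :
  tau k / 2 * \sum_j p j * fnorm (- (submxcol (m%:R^-1 *: (X^T *m ab)) k +
    ((p j)^-1 * m%:R^-1) *:
      ((submxblock X j k)^T *m (submxcol a j - submxcol ab j))) -
    submxcol xi k) ^+ 2 <=
  \sum_j m%:R^-1 * (gamma j / (18 * n%:R)) *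
    (fnorm (submxcol a j - submxcol as_ j) ^+ 2 +
     fnorm (submxcol ab j - submxcol as_ j) ^+ 2).
Proof.
pose b j := - m%:R^-1 *: ((submxblock X j k)^T *m submxcol (ab - as_) j).
pose c j := - m%:R^-1 *: ((submxblock X j k)^T *m submxcol (a - as_) j).
have E j : - (submxcol (m%:R^-1 *: (X^T *m ab)) k + ((p j)^-1 * m%:R^-1) *:
      ((submxblock X j k)^T *m (submxcol a j - submxcol ab j))) -
    submxcol xi k = \sum_i b i + (p j)^-1 *: (c j - b j).
  rewrite /b -scaler_sumr -trmulmx_block /xi submxcolN opprK !submxcolZ.
  rewrite (mulmxBr X^T) submxcolB opprD addrAC; congr (_ + _).
    by rewrite scalerBr !scaleNr opprK.
  rewrite /c -scalerBr -mulmxBr !submxcolB opprB addrA subrK scalerA.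
  by rewrite mulrN scaleNr.
rewrite (eq_bigr _ (fun j _ => congr1 (fun y => p j * fnorm y ^+ 2) (E j))).
apply: le_trans (ler_wpM2l _ (sampled_sqr_bound c b p_gt0 p_sum1)) _.
  by rewrite divr_ge0// ltW// tau_gt0.
rewrite mulrA divfK// mulr_sumr; apply: ler_sum => j _.
have mE : (- m%:R^-1) ^+ 2 = m%:R^-1 * m%:R^-1 :> R by rewrite sqrrN expr2.
rewrite /c /b !fnormZ_sqr mE -mulrDr -!submxcolB.
set U := fnorm (submxcol (a - as_) j) ^+ 2.
set V := fnorm (submxcol (ab - as_) j) ^+ 2.
have cL := fnorm_tr_mul_block (i := j) k (submxcol (a - as_) j).
have bL := fnorm_tr_mul_block (i := j) k (submxcol (ab - as_) j).
apply: (@le_trans _ _ (tau k * ((p j)^-1 * (m%:R^-1 * m%:R^-1 *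
    (Lambda * (U + V)))))).
  rewrite ler_wpM2l ?(ltW (tau_gt0 k))// ler_wpM2l ?invr_ge0 ?(ltW (p_gt0 j))//.
  by rewrite ler_wpM2l ?mulr_ge0 ?invr_ge0// mulrDr lerD.
have -> : tau k * ((p j)^-1 * (m%:R^-1 * m%:R^-1 * (Lambda * (U + V)))) =
    m%:R^-1 * (tau k * ((p j)^-1 * (m%:R^-1 * Lambda))) * (U + V) by ring.
rewrite ler_wpM2r ?addr_ge0 ?exprn_ge0 ?fnorm_ge0//.
by rewrite ler_wpM2l ?invr_ge0// tau_Lambda_le.
Qed.

Definition in_dom (a : 'cV[R]_(\sum_i N i)) :=
  forall i, conjugate (@f i) (submxcol a i) \is a fin_num.

Definition lyapunov (z : 'cV[R]_(\sum_k d k) * 'cV[R]_(\sum_i N i)) :=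
  \sum_i m%:R^-1 * psi_f (submxcol z.2 i) (breg_f (submxcol z.2 i)) +
  \sum_k psi_g (submxcol z.1 k) (breg_g (submxcol z.1 k)).

Definition sqdist (z : 'cV[R]_(\sum_k d k) * 'cV[R]_(\sum_i N i)) :=
  lambda / 2 * fnorm (z.1 - ws) ^+ 2 +
  m%:R^-1 * \sum_i gamma i / 2 * fnorm (submxcol z.2 i - submxcol as_ i) ^+ 2.

Lemma sqdist_le z : in_dom z.2 -> Gamma * sqdist z <= lyapunov z.
Proof.
move=> dz; rewrite /lyapunov /sqdist mulrDr addrC fnorm_block.
rewrite !mulr_sumr; apply: lerD; apply: ler_sum => i _.
  rewrite /psi_f mulrCA ler_wpM2l ?invr_ge0//.
  by rewrite !mulrA lerDl divr_ge0 ?breg_f_ge0// ltW.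
by rewrite /psi_g submxcolB !mulrA lerDl divr_ge0 ?breg_g_ge0// ltW.
Qed.

Lemma step_in_dom wb ab j l z : in_dom z.2 ->
  in_dom (svrg_step X f g p q sigma tau wb ab j l z).2.
Proof.
move=> dz i; rewrite mxcolK; case: ifP => // _.
have as_fin : conjugate (@f i) (submxcol as_ i) \is a fin_num.
  by rewrite conjugate_as.
have H u := (prox_conjugate_ineq (submxcol z.2 i) u (gamma_gt0 i) (sigma_gt0 i)
  (@f_cvx i) (f_smooth i) as_fin).1.
exact: H.
Qed.

Lemma expected_descent wb ab z : in_dom z.2 ->
  \sum_j \sum_l p j * q l *
    lyapunov (svrg_step X f g p q sigma tau wb ab j l z) <=
  (1 - Gamma^-1) * lyapunov z + 1 / 9 * (sqdist z + sqdist (wb, ab)).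
Proof.
case: z => w a /= dz.
pose u i l := submxcol (X *m wb) i + (q l)^-1 *:
  (submxblock X i l *m (submxcol w l - submxcol wb l)).
pose v k j := submxcol (m%:R^-1 *: (X^T *m ab)) k + ((p j)^-1 * m%:R^-1) *:
  ((submxblock X j k)^T *m (submxcol a j - submxcol ab j)).
pose at_ i l := prox (fun x => ((sigma i)%:E * conjugate (@f i) x)%E)
  (submxcol a i + sigma i *: u i l).
pose wt k j := prox (fun x => (tau k * g x)%:E) (submxcol w k - tau k *: v k j).
pose Fi i := psi_f (submxcol a i) (breg_f (submxcol a i)).
pose Fk k := psi_g (submxcol w k) (breg_g (submxcol w k)).
pose Ft i l := psi_f (at_ i l) (breg_f (at_ i l)).
pose Gt k j := psi_g (wt k j) (breg_g (wt k j)).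
(* Linearity of expectation by blocks: a dual block i moves when j = i, to a point depending on l
   only, and a primal block k moves when l = k, to a point depending on j only. *)
have -> : \sum_j \sum_l p j * q l *
      lyapunov (svrg_step X f g p q sigma tau wb ab j l (w, a)) =
    \sum_i m%:R^-1 * (p i * (\sum_l q l * Ft i l) + (1 - p i) * Fi i) +
    \sum_k (q k * (\sum_j p j * Gt k j) + (1 - q k) * Fk k).
  transitivity (\sum_j \sum_l p j * q l *
    (\sum_i m%:R^-1 * (if i == j then Ft i l else Fi i) +
     \sum_k (if k == l then Gt k j else Fk k))).
    apply: eq_bigr => j _; apply: eq_bigr => l _; congr (_ * (_ + _)).
      by apply: eq_bigr => i _; rewrite mxcolK; case: ifP.
    by apply: eq_bigr => k _; rewrite mxcolK; case: ifP.
  under eq_bigr do (under eq_bigr do rewrite mulrDr; rewrite big_split/=).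
  rewrite big_split/=; congr (_ + _).
    under eq_bigr do
      (under eq_bigr do rewrite mulr_sumr; rewrite exchange_big/=).
    rewrite exchange_big/=; apply: eq_bigr => i _.
    rewrite -sum_pick// mulr_sumr; apply: eq_bigr => j _.
    by rewrite mulr_sumr; apply: eq_bigr => l _; rewrite mulrCA.
  under eq_bigr do
      (under eq_bigr do rewrite mulr_sumr; rewrite exchange_big/=).
  rewrite exchange_big/=; apply: eq_bigr => k _.
  rewrite -(sum_pick _ _ _ q_sum1 p_sum1) exchange_big/=.
  by apply: eq_bigr => l _; apply: eq_bigr => j _; rewrite (mulrC (p j)).
have Hf i : p i * (\sum_l q l * Ft i l) + (1 - p i) * Fi i <=
    (1 - Gamma^-1) * Fi i +
    dotv (submxcol (a - as_) i) (submxcol X i *m (w - ws)) +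
    lambda / 18 * (fnorm (w - ws) ^+ 2 + fnorm (wb - ws) ^+ 2).
  have := @descent_f i (submxcol a i) (u i) (at_ i) (dz i) (fun=> erefl).
  rewrite sampled_mean_f -submxcolB -mulmxBr -/(Fi i) => /le_trans; apply.
  by rewrite lerD2l; exact: sampled_noise_f.
have Hg k : q k * (\sum_j p j * Gt k j) + (1 - q k) * Fk k <=
    (1 - Gamma^-1) * Fk k -
    dotv (submxcol (w - ws) k) (submxcol (m%:R^-1 *: (X^T *m (a - as_))) k) +
    \sum_j m%:R^-1 * (gamma j / (18 * n%:R)) *
      (fnorm (submxcol a j - submxcol as_ j) ^+ 2 +
       fnorm (submxcol ab j - submxcol as_ j) ^+ 2).
  have := @descent_g k (submxcol w k) (v k) (wt k) (fun=> erefl).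
  rewrite sampled_mean_g -submxcolB -/(Fk k) => /le_trans; apply.
  have -> : - submxcol (m%:R^-1 *: (X^T *m a)) k - submxcol xi k =
      - submxcol (m%:R^-1 *: (X^T *m (a - as_))) k.
    by rewrite /xi submxcolN opprK mulmxBr scalerBr submxcolB opprB addrC.
  rewrite dotvNr.
  by rewrite lerD2l; exact: sampled_noise_g.
apply: le_trans (lerD (ler_sum _ (fun i _ => ler_wpM2l _ (Hf i)))
                      (ler_sum _ (fun k _ => Hg k))) _.
  by rewrite invr_ge0.
(* Both updates start from the same (w, a), so the two mean coupling terms are the same number <a -
   as, X (w - ws)> / m with opposite signs. *)
rewrite -mulr_sumr !big_split/= -!mulr_sumr sumrN -dotv_block -dotv_mulmx_block.
rewrite dotvZr (dotvC (w - ws)) -dotv_trmx !sumr_const !card_ord /lyapunov/=.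
rewrite /sqdist /= -!mulr_sumr -/Fi -/Fk.
set T := dotv (a - as_) _; set SF := \sum_i Fi i; set SG := \sum_i Fk i.
have -> : (\sum_j m%:R^-1 * (gamma j / (18 * n%:R)) *
      (fnorm (submxcol a j - submxcol as_ j) ^+ 2 +
       fnorm (submxcol ab j - submxcol as_ j) ^+ 2)) *+ n =
    1 / 9 * (m%:R^-1 *
      \sum_i gamma i / 2 * fnorm (submxcol a i - submxcol as_ i) ^+ 2 +
      m%:R^-1 *
      \sum_i gamma i / 2 * fnorm (submxcol ab i - submxcol as_ i) ^+ 2).
  rewrite -mulr_natr mulr_suml -mulrDr -big_split/= !mulr_sumr.
  by apply: eq_bigr => j _; field; rewrite !lt0r_neq0.
move: (\sum_i gamma i / 2 * _) (\sum_i gamma i / 2 * _) => S1 S2.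
rewrite -mulr_natr le_eqVlt; apply/orP; left; apply/eqP.
move: (fnorm (w - ws)) (fnorm (wb - ws)) SF SG T => *.
by field; rewrite !lt0r_neq0// Gamma_gt0.
Qed.

(** * The duality gap compared with the Lyapunov function *)

Definition lagrangian_real (w : 'cV[R]_(\sum_k d k))
    (a : 'cV[R]_(\sum_i N i)) :=
  m%:R^-1 * \sum_i dotv (submxcol a i) (submxcol X i *m w) -
  m%:R^-1 * \sum_i fine (conjugate (@f i) (submxcol a i)) + separable_sum g w.

Lemma lagrangian_realE w a : in_dom a ->
  lagrangian X f g w a = (lagrangian_real w a)%:E.
Proof.
move=> da; rewrite /lagrangian /lagrangian_real !EFinD EFinN [in RHS]EFinM.
have -> : (\sum_i conjugate (@f i) (submxcol a i))%E =
    (\sum_i fine (conjugate (@f i) (submxcol a i)))%:E.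
  by rewrite -sumEFin; apply: eq_bigr => i _; rewrite fineK.
by rewrite EFinM.
Qed.

(** No conjugate is -oo, by Fenchel-Young at 0, so one infinite term makes the sum +oo. Such dual
    points are harmless in the supremum defining [primal] and make [dual] equal to -oo. *)
Lemma lagrangian_eqNy w a : ~ in_dom a -> lagrangian X f g w a = -oo%E.
Proof.
move=> /existsNP[i ai]; rewrite /lagrangian (_ : (\sum_i _)%E = +oo%E).
  by rewrite gt0_muley ?lte_fin ?invr_gt0.
have NNy j : conjugate (@f j) (submxcol a j) != -oo%E.
  rewrite gt_eqF// (lt_le_trans _ (fenchel_young (@f j) _ 0))//.
  exact: ltNyr.
apply/eqP; rewrite esum_eqy//; apply/existsP; exists i => /=.
by move: ai (NNy i); case: (conjugate _ _).
Qed.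

Lemma as_in_dom : in_dom as_. Proof. by move=> i; rewrite conjugate_as. Qed.

Definition gap (w : 'cV[R]_(\sum_k d k)) (a : 'cV[R]_(\sum_i N i)) :=
  \sum_i m%:R^-1 * breg_f (submxcol a i) +
  \sum_k breg_g (submxcol w k).

(** The slopes X ws and xi in the Bregman gaps are those of the coupling at the saddle point, so the
    bilinear terms cancel. *)
Lemma gapE w a : lagrangian_real w as_ - lagrangian_real ws a = gap w a.
Proof.
rewrite /gap /lagrangian_real -mulr_sumr !sumrB.
have -> : \sum_k dotv (submxcol w k - submxcol ws k) (submxcol xi k) =
    dotv (w - ws) xi.
  by rewrite dotv_block; apply: eq_bigr => k _; rewrite submxcolB.
have -> : \sum_i dotv (submxcol a i - submxcol as_ i) (submxcol X i *m ws) =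
    dotv (a - as_) (X *m ws).
  by rewrite dotv_mulmx_block; apply: eq_bigr => i _; rewrite submxcolB.
rewrite /xi dotvNr dotvZr (dotvC (w - ws)) -dotv_trmx.
rewrite -!dotv_mulmx_block mulmxBr dotvBl dotvBr /separable_sum.
by ring.
Qed.

(** Bounds the quadratic remainder of expanding each f_i at X_i ws. Cauchy-Schwarz with weights q_k
    produces Lambda / q_k, to which the bound on Gamma applies; p_i <= 1 removes p_i. *)
Lemma primal_remainder_le (w : 'cV[R]_(\sum_k d k)) :
  m%:R^-1 * \sum_i 1 / gamma i / 2 * fnorm (submxcol X i *m w) ^+ 2 <=
  Gamma / 18 * (lambda / 2 * fnorm w ^+ 2).
Proof.
have H i : 1 / gamma i / 2 * fnorm (submxcol X i *m w) ^+ 2 <=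
    Gamma / 18 * (lambda / 2 * fnorm w ^+ 2).
  have W : fnorm (submxcol X i *m w) ^+ 2 <=
      lambda / 18 * (gamma i * Gamma) * fnorm w ^+ 2.
    rewrite mulmx_blocks.
    apply: le_trans (weighted_sum_sqr _ q_gt0 q_sum1) _.
    rewrite fnorm_block mulr_sumr; apply: ler_sum => k _.
    have V0 : 0 <= fnorm (submxcol w k) ^+ 2 by rewrite exprn_ge0// fnorm_ge0.
    apply: (@le_trans _ _ ((q k)^-1 * (Lambda * fnorm (submxcol w k) ^+ 2))).
      by rewrite ler_wpM2l ?fnorm_mul_block// invr_ge0 ltW.
    rewrite [leLHS]mulrA ler_wpM2r//; apply: le_trans (Lambda_q_le i k) _.
    rewrite ler_wpM2l ?divr_ge0 ?(ltW lambda_gt0)// ler_wpM2l ?ltW//.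
    have := weight_le1 i p_gt0 p_sum1; have := Gamma_gt0; nra.
  apply: le_trans (ler_wpM2l _ W) _; first by rewrite !divr_ge0// ltW.
  by rewrite le_eqVlt; apply/orP; left; apply/eqP; field; rewrite lt0r_neq0.
apply: le_trans (ler_wpM2l _ (ler_sum _ (fun i _ => H i))) _.
  by rewrite invr_ge0.
by rewrite sumr_const card_ord -(mulr_natl (Gamma / 18 * _)) mulKf// lt0r_neq0.
Qed.

Lemma dual_remainder_le (b : 'cV[R]_(\sum_i N i)) :
  lambda^-1 / 2 * fnorm (m%:R^-1 *: (X^T *m b)) ^+ 2 <=
  Gamma / 18 * (m%:R^-1 * \sum_i gamma i / 2 * fnorm (submxcol b i) ^+ 2).
Proof.
rewrite fnormZ_sqr fnorm_block.
have H k : fnorm (submxcol (X^T *m b) k) ^+ 2 <=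
    m%:R * \sum_i gamma i / (18 * n%:R) * (lambda * Gamma) *
      fnorm (submxcol b i) ^+ 2.
  rewrite trmulmx_block; apply: le_trans (weighted_sum_sqr _ p_gt0 p_sum1) _.
  rewrite mulr_sumr; apply: ler_sum => i _.
  have V0 : 0 <= fnorm (submxcol b i) ^+ 2 by rewrite exprn_ge0// fnorm_ge0.
  apply: (@le_trans _ _ ((p i)^-1 * (Lambda * fnorm (submxcol b i) ^+ 2))).
    by rewrite ler_wpM2l ?fnorm_tr_mul_block// invr_ge0 ltW.
  have C : (p i)^-1 * (m%:R^-1 * Lambda) <=
      gamma i / (18 * n%:R) * (lambda * Gamma).
    apply: le_trans (Lambda_p_le i k) _.
    rewrite ler_wpM2l ?divr_ge0 ?(ltW (gamma_gt0 i)) ?mulr_ge0//.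
    rewrite ler_wpM2l ?(ltW lambda_gt0)//.
    have := weight_le1 k q_gt0 q_sum1; have := Gamma_gt0; nra.
  rewrite [leLHS]mulrA [leRHS]mulrA ler_wpM2r//.
  apply: le_trans (ler_wpM2l (ltW m0) C).
  by rewrite mulrCA mulVKf// lt0r_neq0.
apply: le_trans (ler_wpM2l _ (ler_wpM2l _ (ler_sum _ (fun k _ => H k)))) _.
- by rewrite divr_ge0// invr_ge0 ltW.
- exact: sqr_ge0.
rewrite sumr_const card_ord -[_ *+ n]mulr_natl.
rewrite le_eqVlt; apply/orP; left; apply/eqP; rewrite !mulr_sumr.
by apply: eq_bigr => i _; field; rewrite !lt0r_neq0.
Qed.

(** Fenchel-Young replaces the conjugate at a_i by f_i (X_i w), and the descent lemma replaces that
    by its linearization at X_i ws, which is the as_i term of L(w, as). *)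
Lemma primal_le w : (primal X f g w <=
  (lagrangian_real w as_ +
   Gamma / 18 * (lambda / 2 * fnorm (w - ws) ^+ 2))%:E)%E.
Proof.
apply: ge_ereal_sup => _ [a _ <-].
have [da|nda] := pselect (in_dom a); last by rewrite lagrangian_eqNy// leNye.
rewrite lagrangian_realE// lee_fin.
apply: le_trans (lerD (lexx _) (primal_remainder_le (w - ws))).
rewrite /lagrangian_real -!mulrBr -!sumrB addrAC lerD2r -mulrDr -big_split/=.
rewrite ler_wpM2l ?invr_ge0//; apply: ler_sum => i _.
have := fenchel_young (@f i) (submxcol a i) (submxcol X i *m w).
rewrite -[conjugate _ _]fineK// lee_fin conjugate_as/=.
have := descent (f_smooth i) (submxcol X i *m ws) (submxcol X i *m w).
rewrite dotvBr -(mxcolK (fun i => G (submxcol X i *m ws)) i).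
by rewrite -/as_ mulmxBr; lra.
Qed.

(** Smoothness of g^* without g^* itself: strong convexity of g at ws supplies lambda/2 |w - ws|^2,
    which Young's inequality trades against the coupling with a - as. *)
Lemma dual_ge a : in_dom a -> ((lagrangian_real ws a -
  Gamma / 18 * (m%:R^-1 *
    \sum_i gamma i / 2 * fnorm (submxcol (a - as_) i) ^+ 2))%:E <=
  dual X f g a)%E.
Proof.
move=> da; apply: le_ereal_inf_tmp => _ [w _ <-].
rewrite lagrangian_realE// lee_fin.
have := dual_remainder_le (a - as_).
have := g_strong.2 ws w xi ws_opt.
have := @dotv_young _ _ lambda (ws - w) (m%:R^-1 *: (X^T *m (a - as_)))
  lambda_gt0.
rewrite -fnormN opprB dotvZr -(opprB w ws) dotvNl (dotvC (w - ws)) -dotv_trmx.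
rewrite /lagrangian_real /xi dotvNl dotvZl -dotv_trmx mulmxBr dotvBl !dotvBr.
rewrite -!dotv_mulmx_block.
by lra.
Qed.

Lemma dual_eqNy a : ~ in_dom a -> dual X f g a = -oo%E.
Proof.
move=> nda; apply/eqP; rewrite -leeNy_eq -(lagrangian_eqNy ws nda).
by apply: ereal_inf_lbound; exists ws.
Qed.

Lemma primal_ge w : ((lagrangian_real w as_)%:E <= primal X f g w)%E.
Proof.
rewrite -lagrangian_realE; last exact: as_in_dom.
by apply: ereal_sup_ubound; exists as_.
Qed.

Lemma dual_le a : in_dom a -> (dual X f g a <= (lagrangian_real ws a)%:E)%E.
Proof.
by move=> da; rewrite -lagrangian_realE//; apply: ereal_inf_lbound; exists ws.
Qed.

Lemma lyapunovE z : lyapunov z = Gamma * sqdist z +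
  (\sum_i m%:R^-1 * (breg_f (submxcol z.2 i) / p i) +
   \sum_k breg_g (submxcol z.1 k) / q k).
Proof.
rewrite /lyapunov /sqdist fnorm_block mulrDr (addrC (Gamma * _)) !mulr_sumr.
rewrite addrACA -!big_split/=; congr (_ + _); apply: eq_bigr => i _.
  by rewrite /psi_f mulrDr; congr (_ + _); ring.
by rewrite /psi_g submxcolB; congr (_ + _); ring.
Qed.

Lemma sqdist_le_gap w a : in_dom a -> sqdist (w, a) <= gap w a.
Proof.
move=> da; rewrite /sqdist /gap/= addrC fnorm_block !mulr_sumr.
apply: lerD; apply: ler_sum => i _.
  by rewrite ler_wpM2l ?invr_ge0// breg_f_ge.
by rewrite submxcolB breg_g_ge.
Qed.

Lemma lyapunov_ge w a : in_dom a ->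
  gap w a + Gamma * sqdist (w, a) <= lyapunov (w, a).
Proof.
move=> da; rewrite lyapunovE addrC lerD2l; apply: lerD; apply: ler_sum => i _.
  rewrite ler_wpM2l ?invr_ge0// ler_peMr ?breg_f_ge0//.
  by rewrite invf_ge1// weight_le1.
by rewrite ler_peMr ?breg_g_ge0// invf_ge1// weight_le1.
Qed.

(** The factor 2 Gamma arises from one Gamma for the distances, each below its Bregman gap, and one
    for the weights 1 / p_i and 1 / q_k, which are below Gamma. *)
Lemma lyapunov_le w a : in_dom a -> lyapunov (w, a) <= 2 * Gamma * gap w a.
Proof.
move=> da; rewrite lyapunovE -mulrA mulr_natl mulr2n; apply: lerD.
  by rewrite ler_wpM2l ?sqdist_le_gap// ltW// Gamma_gt0.
rewrite /gap mulrDr !mulr_sumr; apply: lerD; apply: ler_sum => i _.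
  rewrite [leRHS]mulrCA ler_wpM2l ?invr_ge0// mulrC ler_wpM2r ?breg_f_ge0//.
  by rewrite -div1r ler_pdivrMr// mulrC ltW.
rewrite mulrC ler_wpM2r ?breg_g_ge0//.
by rewrite -div1r ler_pdivrMr// mulrC ltW.
Qed.

(** The difference P - D lies between [gap] and [gap] plus Gamma/18 times [sqdist]; the distance
    part of the Lyapunov function, with weight Gamma, absorbs this excess. *)
Lemma duality_gap w a : in_dom a ->
  exists2 e, (primal X f g w - dual X f g a)%E = e%:E &
    [/\ 0 <= e, e <= lyapunov (w, a) & lyapunov (w, a) <= 2 * Gamma * e].
Proof.
move=> da; have P1 := primal_ge w; have P2 := primal_le w.
have D1 := dual_ge da; have D2 := dual_le da.
have /fineK PE : primal X f g w \is a fin_num.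
  by rewrite fin_numE -ltey -ltNye (lt_le_trans _ P1) ?ltNyr//
    (le_lt_trans P2) ?ltry.
have /fineK DE : dual X f g a \is a fin_num.
  by rewrite fin_numE -ltey -ltNye (lt_le_trans _ D1) ?ltNyr//
    (le_lt_trans D2) ?ltry.
rewrite -PE in P1 P2 *; rewrite -DE in D1 D2 *.
rewrite !lee_fin in P1 P2 D1 D2.
exists (fine (primal X f g w) - fine (dual X f g a)) => //.
have gE := gapE w a; have L1 := lyapunov_ge w da; have L2 := lyapunov_le w da.
have S0 := sqdist_le_gap w da.
have sE : \sum_i gamma i / 2 * fnorm (submxcol (a - as_) i) ^+ 2 =
    \sum_i gamma i / 2 * fnorm (submxcol a i - submxcol as_ i) ^+ 2.
  by apply: eq_bigr => i _; rewrite submxcolB.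
rewrite sE in D1; have dE : sqdist (w, a) = lambda / 2 * fnorm (w - ws) ^+ 2 +
    m%:R^-1 * \sum_i gamma i / 2 * fnorm (submxcol a i - submxcol as_ i) ^+ 2.
  by [].
have G0 := Gamma_gt0.
have s0 : 0 <= sqdist (w, a).
  rewrite dE; apply: addr_ge0; apply: mulr_ge0; rewrite ?invr_ge0//.
  - by rewrite divr_ge0// ltW.
  - by rewrite exprn_ge0// fnorm_ge0.
  apply: sumr_ge0 => i _; rewrite mulr_ge0 ?exprn_ge0 ?fnorm_ge0//.
  by rewrite divr_ge0// ltW.
have Gs0 : 0 <= Gamma * sqdist (w, a) by rewrite mulr_ge0// ltW.
rewrite dE in L1 S0 s0 Gs0.
move: (lyapunov _) (gap _ _) (fine _) (fine _) (lagrangian_real _ _)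
  (lagrangian_real _ _) (lambda / 2 * _) (m%:R^-1 * _) P1 P2 D1 D2 gE L1 L2 S0
  s0 Gs0 => Ly gp D P LB LA A B P1 P2 D1 D2 gE L1 L2 S0 s0 Gs0.

have gPD : gp <= P - D by lra.
split; [lra|lra|].
by apply: le_trans L2 _; rewrite ler_wpM2l// mulr_ge0// (ltW G0).
Qed.

(** With [sqdist] at most V / Gamma, the rate is 1 - 1/Gamma + 1/(9 Gamma). *)
Lemma expected_contraction zb z : in_dom zb.2 -> in_dom z.2 ->
  \sum_j \sum_l p j * q l *
    lyapunov (svrg_step X f g p q sigma tau zb.1 zb.2 j l z) <=
  (1 - 8 * (9 * Gamma)^-1) * lyapunov z + (9 * Gamma)^-1 * lyapunov zb.
Proof.
case: zb => wb ab /= db dz; apply: le_trans (expected_descent wb ab dz) _.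
have G0 := Gamma_gt0.
have := sqdist_le dz; have := sqdist_le (z := (wb, ab)) db.
move: (lyapunov _) (sqdist _) (lyapunov _) (sqdist _) => Lb Sb L S.
rewrite -!ler_pdivlMl// invfM => Hb H; lra.
Qed.

End Descent.

(** * Random histories and stages *)

Section Histories.
Context (R : realType) (I : finType) (w : I -> R).
Hypotheses (w_ge0 : forall i, 0 <= w i) (w_sum1 : \sum_i w i = 1).

(** The expectation over T independent draws, the most recent one innermost: the mean of a step
    given its past is then an explicit inner sum. *)
Fixpoint history_mean T (Psi : seq I -> R) : R :=
  if T is T'.+1
  then history_mean T' (fun h => \sum_i w i * Psi (rcons h i))
  else Psi [::].

Lemma le_history_mean T (Psi Phi : seq I -> R) :
  (forall h, size h = T -> Psi h <= Phi h) ->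
  history_mean T Psi <= history_mean T Phi.
Proof.
elim: T Psi Phi => [|T IH] Psi Phi le_Psi /=; first exact: le_Psi.
apply: IH => h hT; apply: ler_sum => i _.
by rewrite ler_wpM2l// le_Psi// size_rcons hT.
Qed.

Lemma eq_history_mean T (Psi Phi : seq I -> R) :
  (forall h, size h = T -> Psi h = Phi h) ->
  history_mean T Psi = history_mean T Phi.
Proof.
move=> eq_Psi; apply/eqP; rewrite eq_le.
by rewrite !le_history_mean// => h hT; rewrite eq_Psi.
Qed.

Lemma history_meanD T (Psi Phi : seq I -> R) a b :
  history_mean T (fun h => a * Psi h + b * Phi h) =
  a * history_mean T Psi + b * history_mean T Phi.
Proof.
elim: T Psi Phi => [//|T IH] Psi Phi /=; rewrite -IH; apply: eq_history_mean.
move=> h _; rewrite !mulr_sumr -big_split/=; apply: eq_bigr => i _; ring.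
Qed.

Lemma history_mean_prefix T t (Psi : seq I -> R) :
  (forall h i, (T <= size h)%N -> Psi (rcons h i) = Psi h) ->
  history_mean (T + t) Psi = history_mean T Psi.
Proof.
move=> prefix; elim: t => [|t IH]; first by rewrite addn0.
rewrite addnS/= -IH; apply: eq_history_mean => h hT.
rewrite (eq_bigr (fun i => w i * Psi h)) => [|i _].
  by rewrite -mulr_suml w_sum1 mul1r.
by rewrite prefix// hT leq_addr.
Qed.

Fixpoint histories T : seq (seq I) :=
  if T is T'.+1 then [seq rcons h i | h <- histories T', i <- enum I]
  else [:: [::]].

Lemma history_meanE T Psi :
  history_mean T Psi = \sum_(h <- histories T) (\prod_(i <- h) w i) * Psi h.
Proof.
elim: T Psi => [|T IH] Psi /=; first by rewrite big_seq1 big_nil mul1r.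
rewrite IH big_allpairs_dep; apply: eq_bigr => h _.
rewrite mulr_sumr big_enum/=; apply: eq_bigr => i _.
by rewrite big_rcons/= mulrA.
Qed.

Lemma size_histories T h : h \in histories T -> size h = T.
Proof.
elim: T h => [|T IH] h /=; first by rewrite inE => /eqP ->.
by case/allpairsP => -[h' i] /= [h'T _ ->]; rewrite size_rcons (IH h').
Qed.

(** Writes a functional of the first T draws as a finite combination of indicators, ready to be
    integrated. *)
Lemma sum_histories T (x : nat -> I) (Psi : seq I -> R) :
  Psi (mkseq x T) = \sum_(h <- histories T) Psi h * (mkseq x T == h)%:R.
Proof.
elim: T Psi => [|T IH] Psi /=; first by rewrite big_seq1 eqxx mulr1.
rewrite big_allpairs_dep mkseqS (IH (fun h => Psi (rcons h (x T)))).
apply: eq_bigr => h _; rewrite big_enum/= (bigD1 (x T))//= big1 => [|i ix].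
  by rewrite addr0 eqseq_rcons eqxx andbT.
by rewrite eqseq_rcons [x T == i]eq_sym (negbTE ix) andbF mulr0.
Qed.

End Histories.

Section Expectation.
Context (R : realType) (dd : measure_display) (Omega : measurableType dd).
Context (Pr : probability Omega R) (m n : nat) (p : 'I_m -> R) (q : 'I_n -> R).
Context (J : nat -> Omega -> 'I_m) (K : nat -> Omega -> 'I_n).
Hypothesis JK_draws : independent_draws Pr p q J K.
Context (x0 : 'I_m * 'I_n).

Definition draw omega t := (J t omega, K t omega).

Let w (x : 'I_m * 'I_n) := p x.1 * q x.2.

Let E h (x : nat + nat) := match x with
  | inl t => J t @^-1` [set (nth x0 h t).1]
  | inr t => K t @^-1` [set (nth x0 h t).2]
  end.

Let times T : seq (nat + nat) := map inl (iota 0 T) ++ map inr (iota 0 T).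

(** An intersection over a finite set of indices of the 2 T variables drawn, which is the form that
    [mutually_independent] takes. *)
Lemma history_eventE T h : size h = T ->
  [set omega | mkseq (draw omega) T = h] =
  \bigcap_(x in [set` [fset x in times T]%fset]) E h x.
Proof.
move=> hT; apply/seteqP; split=> omega /=.
  move=> <- x; rewrite /= in_fset mem_cat.
  by move=> /orP[] /mapP[t]; rewrite mem_iota add0n => /andP[_ tT] ->;
    rewrite /E/= nth_mkseq.
move=> Eh; apply: (@eq_from_nth _ x0); rewrite size_mkseq// => t tT.
rewrite nth_mkseq// [RHS]surjective_pairing /draw.
have tI : t \in iota 0 T by rewrite mem_iota.
have -> : J t omega = (nth x0 h t).1.
  by apply: (Eh (inl t)); rewrite /= in_fset mem_cat map_f.
have -> // : K t omega = (nth x0 h t).2.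
by apply: (Eh (inr t)); rewrite /= in_fset mem_cat [X in _ || X]map_f ?orbT.
Qed.

Lemma measurable_history_event T h :
  measurable [set omega | mkseq (draw omega) T = h].
Proof.
have [mJ mK _] := JK_draws.
have [hT|hT] := eqVneq (size h) T; last first.
  rewrite (_ : [set _ | _] = set0)//; apply/seteqP; split=> // omega /= hE.
  by move: hT; rewrite -hE size_mkseq eqxx.
rewrite history_eventE//; apply: fin_bigcap_measurable.
  exact: finite_fset.
by move=> [t|t] _ /=; [exact: (mJ t _).1|exact: (mK t _).1].
Qed.

Lemma probability_history_event T h : size h = T ->
  Pr [set omega | mkseq (draw omega) T = h] = (\prod_(x <- h) w x)%:E.
Proof.
move=> hT; have [mJ mK indep] := JK_draws.
rewrite history_eventE//.
have := indep (fun t => (nth x0 h t).1) (fun t => (nth x0 h t).2)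
  [fset x in times T]%fset.
rewrite (eq_bigcapr (G := E h)); last by move=> [].
move=> ->.
rewrite (perm_big (times T)); last first.
  apply: uniq_perm; first exact: fset_uniq.
    rewrite cat_uniq !map_inj_uniq ?iota_uniq ?andbT//=; try by move=> ? ? [].
    by apply/hasPn => x /mapP[t _ ->]; apply/mapP => -[].
  by move=> x; rewrite in_fset.
rewrite /= big_cat/= !big_map.
rewrite (eq_bigr (fun t => (p (nth x0 h t).1)%:E)); last first.
  by move=> t _; rewrite (mJ t _).2.
rewrite [X in (_ * X)%E](eq_bigr (fun t => (q (nth x0 h t).2)%:E)); last first.
  by move=> t _; rewrite (mK t _).2.
rewrite -{3}(mkseq_nth x0 h) hT big_map big_split/= EFinM.
by congr (_ * _)%E; rewrite (big_morph EFin (id1 := 1%E) (op1 := *%E)).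
Qed.

Lemma integral_history T (Psi : seq ('I_m * 'I_n) -> R) :
  (forall h, 0 <= Psi h) ->
  (\int[Pr]_omega (Psi (mkseq (draw omega) T))%:E =
   (history_mean w T Psi)%:E)%E.
Proof.
move=> Psi0; pose A h := [set omega | mkseq (draw omega) T = h].
pose F h omega := ((Psi h)%:E * (\1_(A h) omega)%:E)%E.
have mA h : measurable (A h) by exact: measurable_history_event.
have PsiE omega : (Psi (mkseq (draw omega) T))%:E =
    (\sum_(h <- histories ('I_m * 'I_n)%type T) F h omega)%E.
  rewrite (sum_histories T (draw omega) Psi) -sumEFin.
  apply: eq_bigr => h _; rewrite /F EFinM indicE; congr (_ * (_%:R)%:E)%E.
  by congr nat_of_bool; apply/eqP/idP; rewrite in_setE.
under eq_integral do rewrite PsiE.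
rewrite ge0_integral_sum//; first last.
- by move=> h omega _; rewrite mule_ge0// lee_fin.
- by move=> h; apply/measurable_funeM/measurable_EFinP; exact: measurable_indic.
rewrite history_meanE -sumEFin big_seq [RHS]big_seq; apply: eq_bigr => h hT.
rewrite ge0_integralZl_EFin//; first last.
  by apply/measurable_EFinP; exact: measurable_indic.
rewrite integral_indic// setIT /A.
transitivity ((Psi h)%:E * (\prod_(i <- h) w i)%:E)%E.
  congr (_ * _)%E; exact: probability_history_event (size_histories hT).
by rewrite EFinM muleC.
Qed.

End Expectation.

Section Stages.
Context (R : realType) (m n : nat) (N : 'I_m -> nat) (d : 'I_n -> nat).
Context (X : 'M[R]_(\sum_i N i, \sum_k d k)).
Context (f : forall i, 'cV[R]_(N i) -> R) (g : forall k, 'cV[R]_(d k) -> R).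
Context (p : 'I_m -> R) (q : 'I_n -> R) (sigma : 'I_m -> R) (tau : 'I_n -> R).

Lemma eq_svrg_inner wb ab j j' l l' t :
  (forall u, (u < t)%N -> j u = j' u) -> (forall u, (u < t)%N -> l u = l' u) ->
  svrg_inner X f g p q sigma tau wb ab j l t =
  svrg_inner X f g p q sigma tau wb ab j' l' t.
Proof.
elim: t => [//|t IH] jj' ll' /=; rewrite jj'// ll'// IH// => u ut.
  by rewrite jj'// ltnW.
by rewrite ll'// ltnW.
Qed.

Context (M : nat) (w0 : 'cV[R]_(\sum_k d k)) (a0 : 'cV[R]_(\sum_i N i)).

Lemma eq_svrg j j' l l' s :
  (forall u, (u < s * M)%N -> j u = j' u) ->
  (forall u, (u < s * M)%N -> l u = l' u) ->
  svrg X f g p q sigma tau M w0 a0 j l s =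
  svrg X f g p q sigma tau M w0 a0 j' l' s.
Proof.
elim: s => [//|s IH] jj' ll' /=.
have lt u : (u < s * M)%N -> (u < s.+1 * M)%N.
  by move=> us; rewrite mulSn (leq_trans us)// leq_addl.
have lt' t : (t < M)%N -> (s * M + t < s.+1 * M)%N.
  by move=> tM; rewrite mulSn addnC ltn_add2r.
rewrite IH; [|by move=> u /lt/jj'|by move=> u /lt/ll'].
by apply: eq_svrg_inner => t tM; [rewrite jj'// lt'|rewrite ll'// lt'].
Qed.

Context (x0 : 'I_m * 'I_n).

(** A finite history is padded with [x0] to an infinite sequence; stage s reads only its first s * M
    entries, so the padding is invisible on long enough histories. *)
Definition stage (h : seq ('I_m * 'I_n)) s :=
  svrg X f g p q sigma tau M w0 a0
    (fun t => (nth x0 h t).1) (fun t => (nth x0 h t).2) s.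

Definition iterate (h : seq ('I_m * 'I_n)) s t :=
  svrg_inner X f g p q sigma tau (stage h s).1 (stage h s).2
    (fun u => (nth x0 h (s * M + u)).1) (fun u => (nth x0 h (s * M + u)).2) t.

Lemma stage_rcons h i s : (s * M <= size h)%N ->
  stage (rcons h i) s = stage h s.
Proof.
move=> sh; rewrite /stage; apply: eq_svrg => u us;
  by rewrite nth_rcons (leq_trans us).
Qed.

Lemma iterate_rcons h i s t : size h = (s * M + t)%N ->
  iterate (rcons h i) s t.+1 =
  svrg_step X f g p q sigma tau (stage h s).1 (stage h s).2 i.1 i.2
    (iterate h s t).
Proof.
move=> hE; have sh : (s * M <= size h)%N by rewrite hE leq_addr.
rewrite /iterate/= stage_rcons// !nth_rcons hE ltnn eqxx.
congr (svrg_step _ _ _ _ _ _ _ _ _ _ _ _).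
by apply: eq_svrg_inner => u ut; rewrite nth_rcons hE ltn_add2l ut.
Qed.

Context (in_D : 'cV[R]_(\sum_k d k) * 'cV[R]_(\sum_i N i) -> Prop).
Hypothesis step_in_D : forall zb j l z, in_D zb -> in_D z ->
  in_D (svrg_step X f g p q sigma tau zb.1 zb.2 j l z).
Hypothesis in_D0 : in_D (w0, a0).

Lemma svrg_inner_in_D zb j l t : in_D zb ->
  in_D (svrg_inner X f g p q sigma tau zb.1 zb.2 j l t).
Proof.
move=> zbD; elim: t => [|t IH]; first by case: zb zbD.
exact: step_in_D.
Qed.

Lemma stage_in_D h s : in_D (stage h s).
Proof. by elim: s => [//|s IH]; exact: svrg_inner_in_D. Qed.

Lemma iterate_in_D h s t : in_D (iterate h s t).
Proof. exact/svrg_inner_in_D/stage_in_D. Qed.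

Hypotheses (p_ge0 : forall i, 0 <= p i) (p_sum1 : \sum_i p i = 1).
Hypotheses (q_ge0 : forall k, 0 <= q k) (q_sum1 : \sum_k q k = 1).
Context (V : 'cV[R]_(\sum_k d k) * 'cV[R]_(\sum_i N i) -> R) (c : R).
Hypothesis V_step : forall zb z, in_D zb -> in_D z ->
  \sum_j \sum_l p j * q l *
    V (svrg_step X f g p q sigma tau zb.1 zb.2 j l z) <=
  (1 - 8 * c) * V z + c * V zb.
Hypothesis V_ge0 : forall z, in_D z -> 0 <= V z.
Hypothesis c8_le1 : 8 * c <= 1.

Let w (x : 'I_m * 'I_n) := p x.1 * q x.2.

Let w_ge0 x : 0 <= w x. Proof. exact: mulr_ge0. Qed.

Let w_sum1 : \sum_x w x = 1.
Proof.
rewrite -(pair_bigA _ (fun i k => p i * q k))/= -[RHS]p_sum1.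
by apply: eq_bigr => i _; rewrite -mulr_sumr q_sum1 mulr1.
Qed.

(** The inner sum over the newest draw is the one-step inequality. The snapshot depends on the first
    s * M draws only, so its mean over the longer history is unchanged. *)
Lemma iterate_mean_step s t :
  history_mean w (s * M + t.+1) (fun h => V (iterate h s t.+1)) <=
  (1 - 8 * c) * history_mean w (s * M + t) (fun h => V (iterate h s t)) +
  c * history_mean w (s * M) (fun h => V (stage h s)).
Proof.
rewrite addnS /= -(@history_mean_prefix _ _ w w_ge0 w_sum1 (s * M) t
  (fun h => V (stage h s)));
  last by move=> h i sh; rewrite stage_rcons.
rewrite -(history_meanD w_ge0).
apply: (le_history_mean w_ge0) => h hE.
apply: le_trans (V_step (stage_in_D h s) (iterate_in_D h s t)).
rewrite pair_bigA/= le_eqVlt; apply/orP; left; apply/eqP.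
apply: eq_bigr => x _; rewrite iterate_rcons//.
Qed.

(** The recursion e' = (1 - 8c) e + c e0 has fixed point e0 / 8, and the initial excess 7/8 e0
    shrinks by 1 - 8c per step. *)
Lemma iterate_mean_le s t :
  history_mean w (s * M + t) (fun h => V (iterate h s t)) <=
  (7 / 8 * (1 - 8 * c) ^+ t + 1 / 8) *
  history_mean w (s * M) (fun h => V (stage h s)).
Proof.
set e0 := history_mean w (s * M) _.
elim: t => [|t IH].
  rewrite addn0 expr0 (_ : _ + _ = 1) ?mul1r; last by field.
  rewrite le_eqVlt; apply/orP; left; apply/eqP/eq_history_mean => // h _.
  by rewrite /iterate/=; case: (stage h s).
apply: le_trans (iterate_mean_step s t) _; rewrite -/e0.
have c0 : 0 <= 1 - 8 * c by rewrite subr_ge0.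
have := ler_wpM2l c0 IH; rewrite exprS.
by move: (history_mean _ _ _) ((1 - 8 * c) ^+ t) => *; lra.
Qed.

(* 7/8 x + 1/8 <= 2/3 if and only if x <= 13/21. *)
Hypothesis rate_le : (1 - 8 * c) ^+ M <= 13 / 21.

Lemma stage_mean_le s :
  history_mean w (s * M) (fun h => V (stage h s)) <= (2 / 3) ^+ s * V (w0, a0).
Proof.
elim: s => [|s IH]; first by rewrite expr0 mul1r.
have e0 : 0 <= history_mean w (s * M) (fun h => V (stage h s)).
  rewrite (_ : 0 = history_mean w (s * M) (fun=> 0)).
    by apply: le_history_mean => // h _; exact/V_ge0/stage_in_D.
  elim: (s * M)%N => //= T IHT; rewrite {1}IHT.
  apply: eq_history_mean => // h _.
  by rewrite big1// => x _; rewrite mulr0.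
rewrite mulSn addnC; apply: le_trans (iterate_mean_le s M) _.
rewrite exprS -(mulrA (2 / 3)).
apply: (@le_trans _ _
    (2 / 3 * history_mean w (s * M) (fun h => V (stage h s)))).
  rewrite ler_wpM2r//; have := rate_le.
  by move: (_ ^+ M) => *; lra.
by rewrite ler_wpM2l// divr_ge0.
Qed.

End Stages.

(** From 1 - x <= exp (- x) the power is at most exp (- 8/9 ln 3). Weakening 8/9 to 1/2 gives 1 /
    sqrt 3, whose square 1/3 is compared with (13/21)^2 by rational arithmetic. *)
Lemma geometric_rate (R : realType) (Gamma : R) M : 1 <= Gamma ->
  ln 3 * Gamma <= M%:R -> (1 - 8 * (9 * Gamma)^-1) ^+ M <= 13 / 21.
Proof.
move=> G1 MG; have G0 : 0 < Gamma by exact: lt_le_trans G1.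
set c := (9 * Gamma)^-1.
have c1 : 8 * c <= 1.
  rewrite /c -[_ * _]/(8 / (9 * Gamma)) ler_pdivrMr ?mulr_gt0//; lra.
have ln3 : 0 <= ln 3 :> R by rewrite ln_ge0// ler1n.
have cM : ln 3 / 9 <= M%:R * c.
  rewrite /c -[_ * _^-1]/(M%:R / (9 * Gamma)) ler_pdivlMr ?mulr_gt0//.
  by rewrite (_ : ln 3 / 9 * (9 * Gamma) = ln 3 * Gamma) -?mulrA ?mulKf.
have cM2 : ln 3 / 2 <= M%:R * (8 * c) by lra.
have rateM : (1 - 8 * c) ^+ M <= expR (- (8 * c)) ^+ M.
  rewrite lerXn2r ?nnegrE ?subr_ge0 ?expR_ge0//.
  exact: expR_ge1Dx.
apply: (le_trans rateM).
apply: (@le_trans _ _ (expR (- (ln 3 / 2)))).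
  by rewrite -expRM_natl ler_expR mulrN lerN2.
have E : expR (- (ln 3 / 2)) * expR (- (ln 3 / 2)) = 3^-1 :> R.
  rewrite -expRD -opprD (_ : ln 3 / 2 + ln 3 / 2 = ln 3); last by field.
  by rewrite expRN lnK// posrE.
move: (expR_ge0 (- (ln 3 / 2) : R)) E; move: (expR _) => y y0 E.
have [//|lt_y] := lerP y (13 / 21).
by nra.
Qed.

Theorem theorem2 (R : realType) (m n : nat) (N : 'I_m -> nat) (d : 'I_n -> nat)
    (m_gt0 : (0 < m)%N) (n_gt0 : (0 < n)%N)
    (N_gt0 : forall i, (0 < N i)%N) (d_gt0 : forall k, (0 < d k)%N)
    (X : 'M[R]_(\sum_i N i, \sum_k d k))
    (f : forall i, 'cV[R]_(N i) -> R) (g : forall k, 'cV[R]_(d k) -> R)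
    (lambda : R) (gamma : 'I_m -> R)
    (lambda_gt0 : 0 < lambda) (gamma_gt0 : forall i, 0 < gamma i)
    (f_convex : forall i, convex_function [set: 'cV[R]_(N i)] (@f i))
    (f_diff : forall i (x : 'cV[R]_(N i)), differentiable (@f i) x)
    (f_smooth : forall i, lipschitz_grad (1 / gamma i) (@f i))
    (g_strong : strongly_convex lambda (separable_sum g))
    (p : 'I_m -> R) (q : 'I_n -> R)
    (p_gt0 : forall i, 0 < p i) (p_sum1 : \sum_i p i = 1)
    (q_gt0 : forall k, 0 < q k) (q_sum1 : \sum_k q k = 1)
    (Lambda Gamma : R)
    (Lambda_ge : forall i k, fnorm (submxblock X i k) ^+ 2 <= Lambda)
    (Gamma_ge : forall i k,
       1 / p i * (1 + 18 * Lambda / (q k * lambda * gamma i)) <= Gamma /\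
       1 / q k * (1 + 18 * n%:R * Lambda / (p i * m%:R * lambda * gamma i))
         <= Gamma)
    (pGamma_gt1 : forall i, 1 < p i * Gamma)
    (qGamma_gt1 : forall k, 1 < q k * Gamma)
    (sigma : 'I_m -> R) (tau : 'I_n -> R)
    (sigmaE : forall i, sigma i = 1 / (gamma i * (p i * Gamma - 1)))
    (tauE : forall k, tau k = 1 / (lambda * (q k * Gamma - 1)))
    (M : nat) (M_gt0 : (0 < M)%N) (M_ge : ln 3 * Gamma <= M%:R)
    (w0 : 'cV[R]_(\sum_k d k)) (a0 : 'cV[R]_(\sum_i N i))
    (dd : measure_display) (Omega : measurableType dd)
    (Pr : probability Omega R)
    (J : nat -> Omega -> 'I_m) (K : nat -> Omega -> 'I_n)
    (JK_draws : independent_draws Pr p q J K)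
    (s : nat) :
  let z omega :=
    svrg X f g p q sigma tau M w0 a0 (fun t => J t omega)
         (fun t => K t omega) s in
  (\int[Pr]_omega (primal X f g (z omega).1 - dual X f g (z omega).2)
   <= ((2 / 3) ^+ s * (2 * Gamma))%:E
      * (primal X f g w0 - dual X f g a0))%E.
Proof.
lazy zeta.
have f_cvx i : cvx (@f i) by apply: convex_function_cvx; exact: f_convex.
have [G fG] : exists G : forall i, 'cV[R]_(N i) -> 'cV[R]_(N i),
    forall i, smooth (@f i) (@G i) (1 / gamma i).
  by exists (fun i => grad (@f i)) => i; exact: smooth_grad.
have [ws ws_opt] :=
  exists_saddle_point X lambda_gt0 f_cvx fG g_strong gamma_gt0.
have G0 : 0 < Gamma by exact: (Gamma_gt0 m_gt0 p_gt0 pGamma_gt1).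
have C0 : 0 < (2 / 3) ^+ s * (2 * Gamma) by rewrite !mulr_gt0// exprn_gt0.
(* Outside the domain the initial dual value is -oo while the primal value is not -oo, so the
   right-hand side is +oo. *)
have [da0|nda0] := pselect (in_dom f a0); last first.
  rewrite (dual_eqNy m_gt0 X g ws nda0).
  have := primal_ge X g f_cvx fG ws w0.
  by case: (primal X f g w0) => [r||]//= _; rewrite gt0_muley ?lte_fin ?leey.
pose V := lyapunov X f g G lambda gamma p q Gamma ws.
pose D (z : 'cV[R]_(\sum_k d k) * 'cV[R]_(\sum_i N i)) := in_dom f z.2.
have gap_e zz : D zz -> exists2 e : R,
    (primal X f g zz.1 - dual X f g zz.2)%E = e%:E &
    [/\ 0 <= e, e <= V zz & V zz <= 2 * Gamma * e].
  case: zz => w a /= da; exact: (duality_gap m_gt0 n_gt0 lambda_gt0 gamma_gt0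
    f_cvx fG g_strong p_gt0 p_sum1 q_gt0 q_sum1 Lambda_ge Gamma_ge pGamma_gt1
    qGamma_gt1 ws_opt w da).
have D_step zb j l zz : D zb -> D zz ->
    D (svrg_step X f g p q sigma tau zb.1 zb.2 j l zz).
  move=> _.
  exact: (step_in_dom X g gamma_gt0 f_cvx fG q pGamma_gt1 tau sigmaE ws).
have V_step zb zz : D zb -> D zz -> \sum_j \sum_l p j * q l *
    V (svrg_step X f g p q sigma tau zb.1 zb.2 j l zz) <=
    (1 - 8 * (9 * Gamma)^-1) * V zz + (9 * Gamma)^-1 * V zb.
  exact: (expected_contraction m_gt0 n_gt0 lambda_gt0 gamma_gt0 f_cvx fG
    g_strong p_gt0 p_sum1 q_gt0 q_sum1 Lambda_ge Gamma_ge pGamma_gt1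
    qGamma_gt1 sigmaE tauE ws_opt).
have V_ge0 zz : D zz -> 0 <= V zz.
  by move=> /gap_e[e _ [e0 eV _]]; exact: le_trans eV.
have G1 : 1 <= Gamma.
  have := weight_le1 (Ordinal m_gt0) p_gt0 p_sum1.
  by have := pGamma_gt1 (Ordinal m_gt0); nra.
have c8 : 8 * (9 * Gamma)^-1 <= 1.
  by rewrite -[_ * _]/(8 / (9 * Gamma)) ler_pdivrMr ?mulr_gt0//; lra.
pose x0 := (Ordinal m_gt0, Ordinal n_gt0).
pose st h := stage X f g p q sigma tau M w0 a0 x0 h s.
have Dz0 : D (w0, a0) by exact: da0.
have st_D h : D (st h) by exact: (stage_in_D M x0 D_step Dz0).
pose gp h := fine (primal X f g (st h).1 - dual X f g (st h).2)%E.
have gpE h : (primal X f g (st h).1 - dual X f g (st h).2)%E = (gp h)%:E.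
  by rewrite /gp; have [e -> _] := gap_e _ (st_D h).
have gp_bounds h : 0 <= gp h /\ gp h <= V (st h).
  by rewrite /gp; have [e -> [e0 eV _]] := gap_e _ (st_D h).
(* The stage reads only the first s * M draws, so the integrand is a function of a finite history
   and the integral becomes a finite mean. *)
have zE omega : svrg X f g p q sigma tau M w0 a0 (J^~ omega) (K^~ omega) s =
    st (mkseq (draw J K omega) (s * M)).
  by rewrite /st /stage; apply: eq_svrg => u us; rewrite nth_mkseq.
rewrite [leLHS](_ : _ =
    \int[Pr]_omega (gp (mkseq (draw J K omega) (s * M)))%:E)%E; last first.
  by apply: eq_integral => omega _; rewrite zE gpE.
rewrite (integral_history JK_draws x0)//; last first.
  by move=> h; have [] := gp_bounds h.
have [e0 -> [_ _ Ve0]] := gap_e _ Dz0.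
rewrite -EFinM lee_fin -mulrA.
have w_ge0 x : 0 <= p x.1 * q x.2 by rewrite mulr_ge0// ltW.
apply: le_trans (le_history_mean w_ge0 (fun h _ => (gp_bounds h).2)) _.
have p_ge0 i := ltW (p_gt0 i); have q_ge0 k := ltW (q_gt0 k).
apply: le_trans (stage_mean_le x0 D_step Dz0 p_ge0 p_sum1 q_ge0 q_sum1 V_step
  V_ge0 c8 (geometric_rate G1 M_ge) s) _.
by rewrite ler_wpM2l// exprn_ge0// divr_ge0.
Qed.
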